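(* Let $d\ge2$, let $L$ be a nondegenerate lattice with an orthogonal action of $G=\mu_d(\mathbb{C})$ satisfying the conditions listed in the context, and set $q=\dim_{\mathbb{C}}(L_{\mathbb{C},1})$. If $d=2$, the period domain $\mathcal{D}_L$ is the disjoint union of two copies of bounded symmetric domains of type $\mathrm{IV}_{q-2}$, of dimension $q-2$. If $d\ge3$, the period domain $\mathcal{D}_L$ is a bounded symmetric domain of type $\mathrm{I}_{1,q-1}$, whence biholomorphic to the complex ball of dimension $q-1$.
   Context: For a finite-dimensional complex representation $V$ of the group $\mu_d(\mathbb{C})$ of complex $d$-th roots of unity, $V_1\subset V$ denotes the subspace on which each $\zeta\in\mu_d(\mathbb{C})$ acts as multiplication by $\zeta$. A lattice or Hermitian form has signature of type $(p,* )$ if its signature is $(p,q)$ for some integer $q\ge0$. $L$ is a nondegenerate lattice of signature of type $(3,* )$, with an orthogonal representation of $G=\mu_d(\mathbb{C})$. Write $(\cdot,\cdot)$ for the $\mathbb{C}$-bilinear extension of its form to $L_{\mathbb{C}}=L\otimes\mathbb{C}$, and $L_{\mathbb{C},1}=(L_{\mathbb{C}})_1$. It is assumed that the Hermitian form $(\sigma,\overline{\sigma'})$ on $L_{\mathbb{C},1}$ is nondegenerate, with signature of type $(2,* )$ if $d=2$ and of type $(1,* )$ if $d\ge3$. The period domain is $$\mathcal{D}_L=\{[\sigma]\in\mathbb{P}(L_{\mathbb{C},1})\mid(\sigma,\sigma)=0\text{ and }(\sigma,\overline{\sigma})>0\},$$ where $\overline{\sigma}$ denotes complex conjugation in $L_{\mathbb{C}}$.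 The domain of type $\mathrm{I}_{m,n}$ consists of the matrices $A\in\mathrm{Mat}_{m\times n}(\mathbb{C})$ such that the Hermitian matrix $E_m-A\overline{A}^t$ is positive definite, where $E_m$ is the identity matrix. The domain of type $\mathrm{IV}_n$ is a connected component of the set of all nonzero $z\in\mathbb{C}^{n+2}$ with $z^tHz=0$ and $\overline{z}^tHz>0$, up to nonzero scalar factors, where $H$ is a real symmetric matrix of signature $(2,n)$. *)

(* Defs.v *)
From HB Require Import structures.
From mathcomp Require Import all_boot all_order all_algebra.
From mathcomp Require Import complex.
From mathcomp Require Import all_classical all_reals all_analysis.

Set Implicit Arguments.
Unset Strict Implicit.
Unset Printing Implicit Defensive.

Import Order.TTheory GRing.Theory Num.Theory.
Import numFieldNormedType.Exports.

Local Open Scope classical_set_scope.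
Local Open Scope ring_scope.

(* Packing R[i] at this structure gives it the norm topology of a numFieldType,
   so that [differentiable] over it means complex differentiable. *)
Definition Cplx (R : realType) : numClosedFieldType := R[i].

Definition mxconj (C : numClosedFieldType) m n (A : 'M[C]_(m, n)) : 'M[C]_(m, n) :=
  map_mx (@Num.conj C) A.

(* In an orthogonal basis, p vectors are positive and r are negative; since
   p + r is then the dimension of U, the form is nondegenerate on U.  Meant for
   symmetric (K real) or Hermitian (K complex) forms. *)
Definition has_signature (K : numFieldType) (V : vectType K) (U : {vspace V})
    (f : V -> V -> K) (p r : nat) : Prop :=
  exists X Y : seq V,
    [/\ size X = p, size Y = r, basis_of U (X ++ Y) &
     [/\ pairwise (fun u v => f u v == 0) (X ++ Y),
         all (fun v => 0 < f v v) X & all (fun v => f v v < 0) Y]].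

(* The lattice is Z^rk, written as row vectors, with (x, y) = x G y^T. *)
Record lattice := Lattice {
  rk : nat;
  gram : 'M[int]_rk;
  gram_sym : gram^T = gram;
  gram_nondeg : \det gram != 0
}.

(* z in mu_d acts on row vectors by x |-> x *m rho z (mu_d is commutative, so
   a right action is a left action).  Values of rho outside mu_d are junk. *)
Record orth_rep (R : realType) (d : nat) (L : lattice) := OrthRep {
  rho :> Cplx R -> 'M[int]_(rk L);
  rho1 : rho 1 = 1%:M;
  rhoM : forall z w : Cplx R, z ^+ d = 1 -> w ^+ d = 1 ->
    rho (z * w) = rho z *m rho w;
  rho_orth : forall z : Cplx R, z ^+ d = 1 ->
    rho z *m gram L *m (rho z)^T = gram L
}.

Section Eigenspace.
Variables (R : realType) (d : nat).
Local Notation C := (Cplx R).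

Definition unity_roots : seq C :=
  sval (closed_field_poly_normal ('X^d - 1 : {poly C})).

Lemma mem_unity_roots (z : C) : (0 < d)%N -> (z \in unity_roots) = (z ^+ d == 1).
Proof.
move=> d0; rewrite /unity_roots; case: closed_field_poly_normal => r /= Dr.
have := congr1 (fun p => root p z) Dr.
rewrite (eqP (monicXnsubC 1 d0)) scale1r root_prod_XsubC => <-.
by rewrite rootE !hornerE subr_eq0.
Qed.

(* V_1 for V = C^n (row vectors) with z in mu_d acting by g z *)
Definition eigen1 n (g : C -> 'M[C]_n) : {vspace 'rV[C]_n} :=
  (\bigcap_(z <- unity_roots) lker (linfun (mulmxr (g z - z%:M))))%VS.

Lemma eigen1P n (g : C -> 'M[C]_n) (v : 'rV[C]_n) : (0 < d)%N ->
  v \in eigen1 g <-> (forall z : C, z ^+ d = 1 -> v *m g z = z *: v).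
Proof.
move=> d0; have E z : (v \in lker (linfun (mulmxr (g z - z%:M)))) = (v *m g z == z *: v).
  by rewrite memv_ker lfunE /= mulmxBr mul_mx_scalar subr_eq0.
rewrite /eigen1; have -> : (v \in (\bigcap_(z <- unity_roots)
    lker (linfun (mulmxr (g z - z%:M))))%VS) =
    all (fun z => v *m g z == z *: v) unity_roots.
  elim: unity_roots => [|z s IH] /=; first by rewrite big_nil memvf.
  by rewrite big_cons memv_cap IH E.
split=> [/allP h z zd|h]; first by apply/eqP/h; rewrite mem_unity_roots// zd.
by apply/allP => z; rewrite mem_unity_roots// => /eqP /h ->.
Qed.

End Eigenspace.

Section Projective.
Variables (R : realType) (n : nat).
Local Notation C := (Cplx R).

Definition nonzero : Type := [set v : 'rV[C]_n | v != 0].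

Definition vec (v : nonzero) : 'rV[C]_n := set_val v.

Definition same_line (u v : nonzero) : bool := (vec u == vec v)%MS.

Lemma same_line_equiv : equiv_class_of same_line.
Proof.
split=> [v|u v|v u w]; rewrite /same_line.
- exact/eqmxP.
- by rewrite andbC.
- by move=> /eqmxP uv /eqmxP vw; apply/eqmxP/(eqmx_trans uv).
Qed.

Canonical same_line_equiv_rel := EquivRelPack same_line_equiv.

Definition projT : Type := quotient_topology {eq_quot same_line}%qT.

Definition line (v : nonzero) : projT := (\pi_{eq_quot same_line} v)%qT.

End Projective.

(* A topological space with a notion of a complex-valued function being
   holomorphic near a point; subsets carry the induced structure (their
   holomorphic functions are locally restrictions of ambient ones), which for a
   complex submanifold is the usual one. *)
Record holoSpace (R : realType) := HoloSpace {
  carrier :> topologicalType;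
  holo_at : carrier -> (carrier -> Cplx R) -> Prop
}.

Definition affine (R : realType) (m n : nat) : holoSpace R :=
  @HoloSpace R 'M[Cplx R]_(m, n)
    (fun x f => \forall y \near x, differentiable f y).

(* f is holomorphic near a point of P^(n-1) when its pullback to C^n \ 0 is
   holomorphic near the vectors above it. *)
Definition projective (R : realType) (n : nat) : holoSpace R :=
  @HoloSpace R (projT R n)
    (fun p f => forall v : nonzero R n, line v = p ->
      exists2 F : 'rV[Cplx R]_n -> Cplx R,
        \forall u \near vec v, differentiable F u &
        \forall w \near v, F (vec w) = f (line w)).

Section Holomorphic.
Variable R : realType.
Local Notation C := (Cplx R).

Definition holomorphic_on (X Y : holoSpace R) (A : set X) (f : X -> Y) : Prop :=
  {within A, continuous f} /\
  forall (x : X) (g : Y -> C), A x -> holo_at (f x) g ->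
    exists2 h : X -> C, holo_at x h &
      \forall y \near within A (nbhs x), g (f y) = h y.

Definition biholomorphic (X Y : holoSpace R) (A : set X) (B : set Y) : Prop :=
  exists (f : X -> Y) (g : Y -> X),
    [/\ f @` A `<=` B, g @` B `<=` A, {in A, cancel f g}, {in B, cancel g f} &
        holomorphic_on A f /\ holomorphic_on B g].

Definition open_in (T : topologicalType) (D A : set T) : Prop :=
  exists2 U : set T, open U & A = D `&` U.

Definition has_complex_dim (X : holoSpace R) (D : set X) (k : nat) : Prop :=
  forall x, D x -> exists (U : set X) (W : set (affine R 1 k)),
    [/\ open U, U x, open W & biholomorphic (D `&` U) W].

Definition posdef m (M : 'M[C]_m) : Prop :=
  forall v : 'rV[C]_m, v != 0 -> 0 < form (@Num.conj C) M v v.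

Definition type_I (m n : nat) : set (affine R m n) :=
  [set A : 'M[C]_(m, n) | posdef (1%:M - A *m (mxconj A)^T)].

Definition complex_ball (n : nat) : set (affine R 1 n) :=
  [set z : 'rV[C]_n | \sum_(i < n) `|z 0 i| ^+ 2 < 1].

Definition period_quadric n (H : 'M[R]_n) : set (projective R n) :=
  let HC : 'M[C]_n := map_mx (real_complex R) H in
  [set line z | z in [set z : nonzero R n |
     form idfun HC (vec z) (vec z) = 0 /\
     0 < form idfun HC (mxconj (vec z)) (vec z)]].

Definition is_type_IV (n : nat) (X : set (projective R (n + 2))) : Prop :=
  exists H : 'M[R]_(n + 2),
    [/\ H^T = H, has_signature fullv (form idfun H) 2 n &
        exists2 x, period_quadric H x &
          X = connected_component (period_quadric H) x].

End Holomorphic.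

Section Period.
Variables (R : realType) (d : nat) (L : lattice) (g : orth_rep R d L).
Local Notation C := (Cplx R).

Definition lattice_form : 'rV[R]_(rk L) -> 'rV[R]_(rk L) -> R :=
  form idfun (map_mx intr (gram L)).

Definition lattice_formC : 'rV[C]_(rk L) -> 'rV[C]_(rk L) -> C :=
  form idfun (map_mx intr (gram L)).

Definition lattice_herm (s t : 'rV[C]_(rk L)) : C := lattice_formC s (mxconj t).

Definition LC1 : {vspace 'rV[C]_(rk L)} :=
  eigen1 d (fun z => map_mx intr (g z)).

(* P(LC1) is embedded in P(L_C). *)
Definition period_domain : set (projective R (rk L)) :=
  [set line s | s in [set s : nonzero R (rk L) |
     [/\ vec s \in LC1, lattice_formC (vec s) (vec s) = 0 &
         0 < lattice_formC (vec s) (mxconj (vec s))]]].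

End Period.

(* Main.v *)
Require Import Defs.
From HB Require Import structures.
From mathcomp Require Import all_boot all_order all_algebra.
From mathcomp Require Import complex.
From mathcomp Require Import all_classical all_reals all_analysis.
From mathcomp Require Import ring.
From mathcomp Require Import cyclic separable cyclotomic.

(** Write U for L_(C,1) and h for the Hermitian form on it.

    For d >= 3 the quadratic equation is automatic: if z is a primitive d-th
    root of unity, then (s, s) = (z s, z s) = z^2 (s, s) on U, and z^2 <> 1
    ([LC1_isotropic]).  So the period domain is the set of h-positive lines of
    U.  In an orthonormal basis of U, with one positive vector and q - 1
    negative ones, a positive line has a unique generator whose positive
    coordinate is 1, and its other coordinates fill the unit ball
    ([ball_chart]); the domain of type I_(1,q-1) is that same ball
    ([type_I_ball]).

    For d = 2, U is the eigenspace of an integral matrix for a real eigenvalue,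
    hence stable under conjugation.  Then U has an orthogonal basis of real
    vectors ([real_orthogonal_basis]), and by Sylvester's law two of them are
    positive ([real_signature]).  After normalisation the lines of the period
    domain are those of coordinates (w, z1, z2) with
    z1^2 + z2^2 = w.w and |w|^2 < |z1|^2 + |z2|^2.  Put u = z1 + i z2 and
    v = z1 - i z2; then u v = w.w and |u|^2 + |v|^2 = 2 (|z1|^2 + |z2|^2), so
    |u| = |v| would give |u|^2 = |w.w| <= |w|^2 < |u|^2.  The period domain
    therefore splits into the two relatively open pieces |u| > |v| and
    |u| < |v| ([quadric_half_union]).  On the first one, scaling u to 1 makes
    v = w.w, and w ranges over the Lie ball |w.w| < 1,
    2 |w|^2 < 1 + |w.w|^2; the second one is the first after replacing i by
    - i, so that it has the same chart ([quadric_chart]).  The Lie ball is open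
    and star-shaped, hence connected, so that for the form
    diag(-1, ..., -1, 1, 1) one of these pieces is a connected component of the
    period quadric, that is, a domain of type IV ([quadric_half_component]).
    Both pieces of the period domain are thus biholomorphic to it through the
    Lie ball.

    All these charts are instances of one statement on cones over subsets of
    projective space, [chart_biholomorphic]. *)

Set Implicit Arguments.
Unset Strict Implicit.
Unset Printing Implicit Defensive.

Import Order.TTheory GRing.Theory Num.Theory.
Import numFieldNormedType.Exports.

Local Open Scope classical_set_scope.
Local Open Scope ring_scope.

(** * Differentiability and continuity in finite dimension *)

Section Diff.
Variable K : numFieldType.

Lemma differentiable_fsum (V W : normedModType K) n (f : 'I_n -> V -> W) x :
  (forall i, differentiable (f i) x) -> differentiable (fun v => \sum_i f i v) x.
Proof.
move=> /differentiable_sum; congr (differentiable _ _).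
by apply/funext => v; rewrite fct_sumE.
Qed.

Lemma differentiable_row (V : normedModType K) n (f : V -> 'rV[K]_n) x :
  (forall i, differentiable (fun v => f v 0 i : K) x) -> differentiable f x.
Proof.
move=> df.
have -> : f = (fun v => \sum_(i < n) f v 0 i *: delta_mx 0 i).
  by apply/funext => v; rewrite -row_sum_delta.
by apply: differentiable_fsum => i; exact: differentiableZl.
Qed.

Lemma differentiable_linear_row n p (f : {linear 'rV[K]_n -> 'rV[K]_p}) x :
  differentiable f x.
Proof.
have -> : (f : _ -> _) = (fun v => \sum_(i < n) v 0 i *: f (delta_mx 0 i)).
  apply/funext => v; rewrite {1}(row_sum_delta v) linear_sum.
  by apply: eq_bigr => i _; rewrite linearZ.
by apply: differentiable_fsum => i; exact/differentiableZl/differentiable_coord.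
Qed.

Lemma differentiable_scale_row (V : normedModType K) n (k : V -> K)
    (f : V -> 'rV[K]_n) x :
  differentiable k x -> differentiable f x ->
  differentiable (fun v => k v *: f v) x.
Proof.
move=> dk df; apply: differentiable_row => i.
rewrite (_ : (fun _ => _) = k * (fun v => f v 0 i)); last first.
  by apply/funext => v; rewrite mxE.
apply: differentiableM => //.
exact: (differentiable_comp df (differentiable_coord _ _ _)).
Qed.

Lemma continuous_fsum (T : topologicalType) (V : normedModType K) n
    (f : 'I_n -> T -> V) x :
  (forall i, {for x, continuous (f i)}) ->
  {for x, continuous (fun v => \sum_i f i v)}.
Proof. by move=> cf; apply: cvg_big => [|i _]; [exact: add_continuous|exact: cf]. Qed.

Lemma near_gt0 (T : topologicalType) (f : T -> K) x :
  {for x, continuous f} -> (forall y, f y \is Num.real) -> 0 < f x ->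
  \forall y \near x, 0 < f y.
Proof.
move=> cf rf fx; have /cvgrPdist_lt/(_ _ fx) : f @ x --> f x := cf.
apply: filterS => y; rewrite real_ltr_norml ?rpredB// => /andP[_].
by rewrite ltrBlDr ltrDl.
Qed.

(** For K = C two numbers are comparable only when their difference is real,
    so x < y is not an open condition on pairs of complex numbers; it becomes
    one between functions with real values. *)
Lemma open_lt_real (T : topologicalType) (f g : T -> K) :
  continuous f -> continuous g ->
  (forall y, f y \is Num.real) -> (forall y, g y \is Num.real) ->
  open [set x | f x < g x].
Proof.
move=> cf cg rf rg.
have c : continuous (fun x => g x - f x).
  by move=> x; apply: cvgB; [exact: cg|exact: cf].
rewrite openE => x /= fg.
have : \forall y \near x, 0 < g y - f y.
  by apply: near_gt0; [exact: c|move=> y; exact: rpredB|rewrite subr_gt0].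
by apply: filterS => y; rewrite subr_gt0.
Qed.

Lemma continuousMl (T : topologicalType) (f : T -> K) a :
  continuous f -> continuous (fun x => a * f x).
Proof. by move=> cf x; apply: cvgM; [exact: cvg_cst|exact: cf]. Qed.

Lemma continuousDl (T : topologicalType) (f : T -> K) a :
  continuous f -> continuous (fun x => a + f x).
Proof. by move=> cf x; apply: cvgD; [exact: cvg_cst|exact: cf]. Qed.

Lemma continuous_sqr (T : topologicalType) (f : T -> K) :
  continuous f -> continuous (fun x => f x ^+ 2).
Proof.
move=> cf x; rewrite (_ : (fun v => _) = (fun v => f v * f v)).
  by apply: cvgM; exact: cf.
by apply/funext => v; rewrite expr2.
Qed.

Lemma continuous_normr (T : topologicalType) (f : T -> K) :
  continuous f -> continuous (fun x => `|f x|).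
Proof. by move=> cf x; apply: cvg_norm; exact: cf. Qed.

Lemma continuous_coord m i : continuous (fun w : 'rV[K]_m => w 0 i).
Proof. exact: coord_continuous. Qed.

End Diff.

Lemma differentiable_id (K : numFieldType) (V : normedModType K) (x : V) :
  differentiable id x.
Proof. by have [] := is_diff_id x. Qed.

Lemma differentiable_row_mx (K : numFieldType) (V : normedModType K) m p
    (f : V -> 'rV[K]_m) (g : V -> 'rV[K]_p) x :
  differentiable f x -> differentiable g x ->
  differentiable (fun v => row_mx (f v) (g v)) x.
Proof.
move=> df dg; apply: differentiable_row => i.
case: (split_ordP i) => k ->.
  rewrite (_ : (fun _ => _) = (fun v => f v 0 k)); last first.
    by apply/funext => v; rewrite row_mxEl.
  exact: (differentiable_comp df (differentiable_coord _ _ _)).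
rewrite (_ : (fun _ => _) = (fun v => g v 0 k)); last first.
  by apply/funext => v; rewrite row_mxEr.
exact: (differentiable_comp dg (differentiable_coord _ _ _)).
Qed.

(** * Biholomorphic maps *)

Section Comp.
Variable R : realType.
Local Notation C := (Cplx R).

(** The germ identities defining [holomorphic_on] hold only within the given
    subsets.  One that holds within B near f x can be pulled back to A because f
    maps A into B and is continuous within A. *)
Lemma holomorphic_on_comp (X Y Z : holoSpace R) (A : set X) (B : set Y)
    (f : X -> Y) (g : Y -> Z) :
  f @` A `<=` B -> holomorphic_on A f -> holomorphic_on B g ->
  holomorphic_on A (g \o f).
Proof.
move=> fAB [/subspace_continuousP cf hf] [/subspace_continuousP cg hg].
have cfA x : A x -> f @ within A (nbhs x) --> within B (nbhs (f x)).
  move=> Ax P nP; have : nbhs x [set y | A y -> B (f y) -> P (f y)].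
    exact: cf x Ax _ nP.
  suff : nbhs x [set y | A y -> B (f y) -> P (f y)] ->
         nbhs x [set y | A y -> P (f y)] by [].
  by apply: filterS => y + Ay; apply => //; apply: fAB; exists y.
split.
  apply/subspace_continuousP => x Ax.
  apply: cvg_comp; first exact: cfA.
  by apply: cg; apply: fAB; exists x.
move=> x k Ax hk.
have Bfx : B (f x) by apply: fAB; exists x.
have [h hh kh] := hg _ _ Bfx hk.
have [h' hh' h'E] := hf _ _ Ax hh.
exists h' => //.
have kh' : \forall y \near within A (nbhs x), k (g (f y)) = h (f y).
  exact: (cfA _ Ax _ kh).
apply: filterS2 h'E kh' => y; rewrite -[(g \o f) y]/(g (f y)).
by move=> <- ->.
Qed.

Lemma biholomorphic_sym (X Y : holoSpace R) (A : set X) (B : set Y) :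
  biholomorphic A B -> biholomorphic B A.
Proof. by move=> [f [g [? ? ? ? []]]]; exists g, f. Qed.

Lemma biholomorphic_trans (Y X Z : holoSpace R) (A : set X) (B : set Y)
    (D : set Z) :
  biholomorphic A B -> biholomorphic B D -> biholomorphic A D.
Proof.
move=> [f [f' [fA fB ff' f'f [hf hf']]]] [g [g' [gB gD gg' g'g [hg hg']]]].
exists (g \o f), (f' \o g'); split.
- by move=> _ [x Ax <-]; apply: gB; exists (f x) => //; apply: fA; exists x.
- by move=> _ [x Dx <-]; apply: fB; exists (g' x) => //; apply: gD; exists x.
- move=> x xA /=; rewrite gg' ?ff'//.
  by apply/mem_set/fA; exists x => //; exact/set_mem.
- move=> x xD /=; rewrite f'f ?g'g//.
  by apply/mem_set/gD; exists x => //; exact/set_mem.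
by split; [apply: (@holomorphic_on_comp _ _ _ _ B)|
           apply: (@holomorphic_on_comp _ _ _ _ B)].
Qed.

(** One global chart serves as a local chart at every point. *)
Lemma biholomorphic_dim (X : holoSpace R) (D : set X) k (W : set (affine R 1 k)) :
  open W -> biholomorphic D W -> has_complex_dim D k.
Proof.
by move=> oW DW x Dx; exists setT, W; rewrite setIT; split => //; exact: openT.
Qed.

End Comp.

(** * Cones and lines *)

Section Lines.
Variables (R : realType) (n : nat).
Local Notation C := (Cplx R).
Implicit Types (u v : nonzero R n).

Lemma vec_neq0 v : vec v != 0.
Proof. exact: set_mem (valP v). Qed.

Definition nonzero_of (x : 'rV[C]_n) (x0 : x != 0) : nonzero R n :=
  SigSub (mem_set x0 : x \in [set v : 'rV[C]_n | v != 0]).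

Lemma eq_line u v : line u = line v <-> exists2 a : C, a != 0 & vec u = a *: vec v.
Proof.
split.
  move/eqquotP; rewrite /= /same_line => /andP[/sub_rVP[a E] _].
  exists a => //; apply: contraTneq (vec_neq0 u) => a0.
  by rewrite E a0 scale0r negbK.
move=> [a a0 E]; apply/eqquotP; rewrite /= /same_line E.
by apply/eqmxP; exact: eqmx_scale.
Qed.

Lemma lineP (p : projective R n) : exists v, p = line v.
Proof. by exists (repr p); rewrite /line reprK. Qed.

Lemma continuous_vec : continuous (@vec R n).
Proof. exact: initial_continuous. Qed.

Lemma near_vec v (P : set 'rV[C]_n) :
  (\forall x \near vec v, P x) -> \forall u \near v, P (vec u).
Proof. exact: (continuous_vec (x:=v)). Qed.

Lemma cvg_nonzero T (F : set_system T) (f : T -> nonzero R n) v : Filter F ->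
  (fun t => vec (f t)) @ F --> vec v -> f @ F --> v.
Proof.
move=> FF cf P [_ [[U oU <-] /= Uv UP]].
have : \forall t \near F, U (vec (f t)).
  by apply: cf; apply: open_nbhs_nbhs.
by apply: filterS => t Ut; exact: UP.
Qed.

Lemma continuous_line : continuous (@line R n).
Proof. exact: pi_continuous. Qed.

Definition cone_invariant (P : set 'rV[C]_n) :=
  forall (a : C) x, a != 0 -> P x -> P (a *: x).

Definition proj_of (P : set 'rV[C]_n) : set (projective R n) :=
  [set line v | v in [set v | P (vec v)]].

Lemma proj_ofE P v : cone_invariant P -> proj_of P (line v) <-> P (vec v).
Proof.
move=> iP; split; last by move=> Pv; exists v.
by move=> [u Pu /esym/eq_line[a a0 ->]]; exact: iP.
Qed.

(** The vectors lying over the projection of a cone are those of the cone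
    itself, which is how open sets of the quotient topology are recognised. *)
Lemma open_proj_of P : cone_invariant P -> open P -> open (proj_of P).
Proof.
move=> iP oP.
rewrite /open/= /quotient_open.
rewrite (_ : _ @^-1` _ = @vec R n @^-1` P).
  by apply: open_comp => // x _; exact: continuous_vec.
by apply/seteqP; split => v /= /(proj_ofE v iP).
Qed.

Lemma cone_invariantI (P Q : set 'rV[C]_n) :
  cone_invariant P -> cone_invariant Q -> cone_invariant (P `&` Q).
Proof. by move=> iP iQ a x a0 [Px Qx]; split; [exact: iP|exact: iQ]. Qed.

Lemma proj_ofI (P Q : set 'rV[C]_n) : cone_invariant P -> cone_invariant Q ->
  proj_of (P `&` Q) = proj_of P `&` proj_of Q.
Proof.
move=> iP iQ; apply/seteqP; split => p; have [v ->] := lineP p.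
  move=> /(proj_ofE _ (cone_invariantI iP iQ))[Pv Qv].
  by split; apply/proj_ofE.
by move=> [/(proj_ofE _ iP) Pv /(proj_ofE _ iQ) Qv]; exists v.
Qed.

End Lines.

(** * Affine charts of projective sets *)

Section Chart.
Variables (R : realType) (n m : nat).
Local Notation C := (Cplx R).
Variables (k : 'cV[C]_n) (K : 'M[C]_(n, m)).

Definition denom (v : 'rV[C]_n) : C := (v *m k) 0 0.

(** The point of C^m with homogeneous coordinates [v *m k : v *m K].  With
    the convention 0^-1 = 0 it is invariant under scaling even on the hyperplane
    where the denominator vanishes, so that it descends to the whole projective
    space. *)
Definition ratio (v : 'rV[C]_n) : 'rV[C]_m := ((v *m k) 0 0)^-1 *: (v *m K).

Lemma differentiable_denom v : differentiable denom v.
Proof.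
have d1 : differentiable (mulmxr k : 'rV[C]_n -> 'rV[C]_1) v.
  exact: differentiable_linear_row.
exact: (differentiable_comp d1 (differentiable_coord _ _ _)).
Qed.

Lemma differentiable_ratio (v : 'rV[C]_n) : (v *m k) 0 0 != 0 -> differentiable ratio v.
Proof.
move=> v0; apply: differentiable_scale_row.
  exact/differentiableV/v0/differentiable_denom.
exact: (differentiable_linear_row (mulmxr K)).
Qed.

Lemma near_denom_neq0 (v : 'rV[C]_n) : (v *m k) 0 0 != 0 ->
  \forall x \near v, (x *m k) 0 0 != 0.
Proof.
move=> v0; have c := differentiable_continuous (differentiable_denom v).
exact: (cvgr_neq0 (denom v) c v0).
Qed.

Lemma ratioZ (a : C) v : a != 0 -> ratio (a *: v) = ratio v.
Proof.
by move=> a0; rewrite /ratio -!scalemxAl mxE scalerA invfM mulrAC mulVf// mul1r.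
Qed.

Lemma near_ratio (v : 'rV[C]_n) (O : set 'rV[C]_m) : (v *m k) 0 0 != 0 ->
  (\forall w \near ratio v, O w) -> \forall x \near v, O (ratio x).
Proof.
move=> v0; exact: (differentiable_continuous (differentiable_ratio v0)).
Qed.

Definition affine_coord (p : projective R n) : affine R 1 m := ratio (vec (repr p)).

Lemma affine_coordE (v : nonzero R n) : affine_coord (line v) = ratio (vec v).
Proof.
rewrite /affine_coord.
have /eq_line[a a0 E] : line (repr (line v)) = line v by rewrite /line reprK.
by rewrite E ratioZ.
Qed.

(** The preimage of an open set U contains the projection of the cone of all
    vectors with nonzero denominator and ratio in U, and this cone is open. *)
Lemma affine_coord_continuous (v : nonzero R n) : (vec v *m k) 0 0 != 0 ->
  {for line v, continuous affine_coord}.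
Proof.
move=> v0 O; rewrite /= affine_coordE => nO.
have [U [oU Uv] UO] : exists2 U, open_nbhs (ratio (vec v)) U & U `<=` O.
  have E := nbhsE (ratio (vec v) : 'rV[C]_m).
  by move: nO; rewrite E.
pose Q := [set x : 'rV[C]_n | (x *m k) 0 0 != 0 /\ U (ratio x)].
have iQ : cone_invariant Q.
  move=> a x a0 [x0 Ux]; split; last by rewrite ratioZ.
  by rewrite -scalemxAl mxE mulf_neq0.
have oQ : open Q.
  rewrite openE => x [x0 Ux]; apply: filterI; first exact: near_denom_neq0.
  by apply: near_ratio => //; apply: open_nbhs_nbhs.
have nQ : nbhs (line v) (proj_of Q).
  apply: open_nbhs_nbhs; split; first exact: open_proj_of.
  exact/proj_ofE.
apply: filterS nQ => _ [u [_ Uu] <-]; apply: UO.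
by rewrite affine_coordE.
Qed.

(** Pulled back to C^n, the function g \o affine_coord is g \o ratio, a
    composite of differentiable functions off the hyperplane k = 0. *)
Lemma affine_coord_holomorphic (A : set (projective R n)) :
  (forall v, A (line v) -> (vec v *m k) 0 0 != 0) ->
  holomorphic_on A affine_coord.
Proof.
move=> A0; split.
  apply: continuous_in_subspaceT => p /set_mem.
  by have [v ->] := lineP p => /A0; exact: affine_coord_continuous.
move=> p g Ap hg; exists (g \o affine_coord); last exact: nearW.
move=> v vp; have v0 : (vec v *m k) 0 0 != 0 by apply: A0; rewrite vp.
have gE w : (g \o ratio) (vec w) = (g \o affine_coord) (line w).
  by rewrite /= affine_coordE.
exists (g \o ratio); last first.
  exact: (@filterE _ (nbhs v) (nbhs_filter v) _ gE).
have {}hg : \forall y \near ratio (vec v), differentiable g y.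
  by move: hg; rewrite -vp affine_coordE.
have := near_ratio v0 hg; apply: filterS2 (near_denom_neq0 v0) => x x0 gx.
exact: (differentiable_comp (differentiable_ratio x0) gx).
Qed.

Section Lift.
Variable s : 'rV[C]_m -> 'rV[C]_n.
Hypothesis ds : forall w, differentiable s w.
Hypothesis s0 : forall w, s w != 0.

(** Requiring s to vanish nowhere, and not only on the domain of the chart,
    makes this a total map into projective space. *)
Definition section_line (w : affine R 1 m) : projective R n := line (nonzero_of (s0 w)).

Lemma continuous_lift : continuous (fun w : 'rV[C]_m => nonzero_of (s0 w)).
Proof.
move=> w; have cs : s x @[x --> w] --> s w := differentiable_continuous (ds w).
exact: (@cvg_nonzero _ _ _ (nbhs w) (fun x => nonzero_of (s0 x))
          (nonzero_of (s0 w)) (nbhs_filter w) cs).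
Qed.

Lemma near_lift (w : 'rV[C]_m) (Q : nonzero R n -> Prop) :
  (\forall x \near nonzero_of (s0 w), Q x) -> \forall y \near w, Q (nonzero_of (s0 y)).
Proof. exact: (continuous_lift (x:=w)). Qed.

Lemma section_line_continuous : continuous section_line.
Proof.
move=> w; apply: (continuous_comp (continuous_lift (x:=w))).
exact: continuous_line.
Qed.

(** A function holomorphic near a line is, near the chosen vector s w, a
    differentiable function of the vector; composing it with s gives the
    required extension. *)
Lemma section_line_holomorphic W : holomorphic_on W section_line.
Proof.
split; first exact/continuous_subspaceT/section_line_continuous.
move=> w g Ww /(_ _ erefl)[F dF Fg].
have nF := near_lift (w := w) (Q := fun x => differentiable F (vec x)) (near_vec dF).
have nG := near_lift (w := w) (Q := fun x => F (vec x) = g (line x)) Fg.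
exists (F \o s).
  have dFs y : differentiable F (s y) -> differentiable (F \o s) y.
    by move=> dFy; exact: (differentiable_comp (ds y) dFy).
  exact: (@filterS _ (nbhs w) (nbhs_filter w) _ _ dFs).
apply: cvg_within.
have E y : F (vec (nonzero_of (s0 y))) = g (line (nonzero_of (s0 y))) ->
  g (section_line y) = (F \o s) y by move=> <-.
exact: (@filterS _ (nbhs w) (nbhs_filter w) _ _ E nG).
Qed.

End Lift.

(** The section s picks on each line of the cone P the vector on which the
    linear form k equals 1, and its affine coordinates are then w.  So the map
    from lines to coordinates and the map from w to the line of s w are inverse
    to each other. *)
Theorem chart_biholomorphic (s : 'rV[C]_m -> 'rV[C]_n) (P : set 'rV[C]_n)
    (W : set (affine R 1 m)) :
  (forall w, differentiable s w) -> (forall w, (s w *m k) 0 0 = 1) ->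
  (forall w, s w *m K = w) -> cone_invariant P ->
  (forall v, P v -> exists a w, [/\ a != 0, W w & v = a *: s w]) ->
  (forall w, W w -> P (s w)) ->
  biholomorphic (proj_of P : set (projective R n)) W.
Proof.
move=> ds sk sK iP PW WP.
have s0 w : s w != 0.
  by apply: contra_eq_neq (sk w) => ->; rewrite mul0mx mxE eq_sym oner_eq0.
have rs w : ratio (s w) = w by rewrite /ratio sk sK invr1 scale1r.
exists affine_coord, (section_line s0); split.
- move=> _ [_ [v Pv <-] <-]; rewrite affine_coordE.
  by have [a [w [a0 Ww ->]]] := PW _ Pv; rewrite ratioZ// rs.
- by move=> _ [w Ww <-]; apply/proj_ofE => //=; exact: WP.
- move=> _ /set_mem[v Pv <-]; rewrite affine_coordE; apply/eq_line.
  have [a [w [a0 Ww E]]] := PW _ Pv; rewrite E ratioZ// rs.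
  by exists a^-1; rewrite ?invr_eq0//= scalerA mulVf// scale1r.
- by move=> w _; rewrite affine_coordE /= rs.
split; last exact: section_line_holomorphic.
apply: affine_coord_holomorphic => v /(proj_ofE _ iP) /PW[a [w [a0 _ ->]]].
by rewrite -scalemxAl mxE sk mulr1.
Qed.

(** Used to transport connectedness from the coordinate domain. *)
Lemma section_image (s : 'rV[C]_m -> 'rV[C]_n) (P : set 'rV[C]_n)
    (W : set (affine R 1 m)) (s0 : forall w, s w != 0) :
  (forall v, P v -> exists a w, [/\ a != 0, W w & v = a *: s w]) ->
  (forall w, W w -> P (s w)) ->
  section_line s0 @` W = proj_of P.
Proof.
move=> PW WP; apply/seteqP; split.
  by move=> _ [w Ww <-]; exists (nonzero_of (s0 w)) => //; exact: WP.
move=> _ [v Pv <-]; have [a [w [a0 Ww E]]] := PW _ Pv.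
by exists w => //; apply/esym/eq_line; exists a.
Qed.

End Chart.

(** * Sums of squares, isotropic coordinates and the Lie ball *)

Lemma sum_ord2 (V : nmodType) (F : 'I_2 -> V) : \sum_(i < 2) F i = F 0 + F 1.
Proof. by rewrite big_ord_recl big_ord1; congr (_ + F _); exact: val_inj. Qed.

Section Norms.
Variable C : numClosedFieldType.

Definition sqnorm n (w : 'rV[C]_n) : C := \sum_i `|w 0 i| ^+ 2.
Definition sqsum n (w : 'rV[C]_n) : C := \sum_i w 0 i ^+ 2.

Lemma sqnorm_ge0 n (w : 'rV[C]_n) : 0 <= sqnorm w.
Proof. by apply: sumr_ge0 => i _; rewrite exprn_ge0. Qed.

Lemma sqnorm_real n (w : 'rV[C]_n) : sqnorm w \is Num.real.
Proof. exact/ger0_real/sqnorm_ge0. Qed.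

Lemma sqnormZ n (a : C) (w : 'rV[C]_n) : sqnorm (a *: w) = `|a| ^+ 2 * sqnorm w.
Proof.
by rewrite /sqnorm mulr_sumr; apply: eq_bigr => i _; rewrite mxE normrM exprMn.
Qed.

Lemma sqsumZ n (a : C) (w : 'rV[C]_n) : sqsum (a *: w) = a ^+ 2 * sqsum w.
Proof.
by rewrite /sqsum mulr_sumr; apply: eq_bigr => i _; rewrite mxE exprMn.
Qed.

Lemma norm_sqsum_le n (w : 'rV[C]_n) : `|sqsum w| <= sqnorm w.
Proof.
apply: (le_trans (ler_norm_sum _ _ _)).
by apply: ler_sum => i _; rewrite normrX.
Qed.

Lemma sqnorm2 (z : 'rV[C]_2) : sqnorm z = `|z 0 0| ^+ 2 + `|z 0 1| ^+ 2.
Proof. exact: sum_ord2. Qed.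

Lemma sqsum2 (z : 'rV[C]_2) : sqsum z = z 0 0 ^+ 2 + z 0 1 ^+ 2.
Proof. exact: sum_ord2. Qed.

Section Isotropic.
Variable j : C.

(** The linear factors of z1^2 + z2^2 attached to a square root j of -1;
    changing j into - j exchanges them. *)
Definition iso1 (z : 'rV[C]_2) : C := z 0 0 + j * z 0 1.
Definition iso2 (z : 'rV[C]_2) : C := z 0 0 - j * z 0 1.
Definition of_iso (a b : C) : 'rV[C]_2 :=
  \row_(i < 2) (if i == 0 then (a + b) / 2 else (a - b) / (2 * j)).

Lemma iso1Z a z : iso1 (a *: z) = a * iso1 z.
Proof. by rewrite /iso1 !mxE; ring. Qed.

Lemma iso2Z a z : iso2 (a *: z) = a * iso2 z.
Proof. by rewrite /iso2 !mxE; ring. Qed.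

Hypothesis j2 : j ^+ 2 = -1.

Lemma sqrtN1_neq0 : j != 0.
Proof. by apply: contra_eq_neq j2 => ->; rewrite expr0n eq_sym oppr_eq0 oner_eq0. Qed.

Lemma iso_mul z : iso1 z * iso2 z = sqsum z.
Proof. by rewrite sqsum2 /iso1 /iso2 mulrC -subr_sqr exprMn j2 mulN1r opprK. Qed.

(** This is the parallelogram identity for z1 and j z2, since |j| = 1. *)
Lemma iso_sqnorm z : `|iso1 z| ^+ 2 + `|iso2 z| ^+ 2 = 2 * sqnorm z.
Proof.
have nj : `|j| ^+ 2 = 1 by rewrite -normrX j2 normrN1.
have -> : 2 * sqnorm z = 2 * (`|z 0 0| ^+ 2 + `|j * z 0 1| ^+ 2).
  by rewrite sqnorm2 normrM exprMn nj mul1r.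
rewrite /iso1 /iso2; move: (z 0 0) (j * _) => a b.
rewrite !normCK raddfD raddfB /=; ring.
Qed.

Lemma iso1_of a b : iso1 (of_iso a b) = a.
Proof. by rewrite /iso1 !mxE/=; field; exact: sqrtN1_neq0. Qed.

Lemma iso2_of a b : iso2 (of_iso a b) = b.
Proof. by rewrite /iso2 !mxE/=; field; exact: sqrtN1_neq0. Qed.

Lemma of_iso_eq z : of_iso (iso1 z) (iso2 z) = z.
Proof.
apply/rowP => i; rewrite !mxE; case: ifPn => [/eqP ->|i0].
  by rewrite /iso1 /iso2; field.
have -> : i = 1 by apply: val_inj; case: i i0 => -[|[]].
by rewrite /iso1 /iso2; field; exact: sqrtN1_neq0.
Qed.

Lemma of_isoZ c a b : c *: of_iso a b = of_iso (c * a) (c * b).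
Proof.
by apply/rowP => i; rewrite !mxE; case: ifP => _; rewrite -?mulrDr -?mulrBr mulrA.
Qed.

Definition iso1_mx : 'cV[C]_2 := \col_i (if i == 0 then 1 else j).

Lemma mul_iso1_mx z : (z *m iso1_mx) 0 0 = iso1 z.
Proof. by rewrite !mxE sum_ord2 !mxE /= mulr1 mulrC. Qed.

End Isotropic.

Lemma iso1N j z : iso1 (- j) z = iso2 j z.
Proof. by rewrite /iso1 /iso2 mulNr. Qed.

Lemma iso2N j z : iso2 (- j) z = iso1 j z.
Proof. by rewrite /iso1 /iso2 mulNr opprK. Qed.

End Norms.

Section Domains.
Variable R : realType.
Local Notation C := (Cplx R).

Lemma continuous_sqnorm m : continuous (@sqnorm C m).
Proof.
move=> w; apply: continuous_fsum => i; apply: continuous_sqr.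
exact/continuous_normr/continuous_coord.
Qed.

Lemma continuous_sqsum m : continuous (@sqsum C m).
Proof.
move=> w; apply: continuous_fsum => i; apply: continuous_sqr.
exact: continuous_coord.
Qed.

(** The bounded realisation of the domain of type IV_m. *)
Definition lie_ball m : set (affine R 1 m) :=
  [set w : 'rV[C]_m | `|sqsum w| < 1 /\ 2 * sqnorm w < 1 + `|sqsum w| ^+ 2].

Lemma open_lie_ball m : open (@lie_ball m).
Proof.
have cs : continuous (fun w : 'rV[C]_m => `|sqsum w|).
  exact/continuous_normr/continuous_sqsum.
apply: openI; apply: open_lt_real.
- exact: cs.
- exact: cst_continuous.
- by move=> w; rewrite normr_real.
- by [].
- exact/continuousMl/continuous_sqnorm.
- exact/continuousDl/continuous_sqr/cs.
- by move=> w; rewrite rpredM ?sqnorm_real ?realn.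
- by move=> w; rewrite rpredD ?rpredX ?real1 ?normr_real.
Qed.

Lemma lie_ball0 m : lie_ball (0 : 'rV[C]_m).
Proof.
have E : sqsum (0 : 'rV[C]_m) = 0 by rewrite /sqsum big1// => i _; rewrite mxE expr0n.
have E' : sqnorm (0 : 'rV[C]_m) = 0.
  by rewrite /sqnorm big1// => i _; rewrite mxE normr0 expr0n.
by rewrite /lie_ball/= E E' normr0 mulr0 expr0n addr0 ltr01.
Qed.

(** With a = |w.w|, b = |w|^2 and s = t^2, the second inequality for t w reads
    0 < 1 + s^2 a^2 - 2 s b, and the right-hand side decreases on [0, 1] because
    a < 1 and a <= b. *)
Lemma lie_ball_star m (t : C) (w : 'rV[C]_m) :
  0 <= t -> t <= 1 -> lie_ball w -> lie_ball (t *: w).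
Proof.
move=> t0 t1 [w1 w2]; rewrite /lie_ball/= sqsumZ sqnormZ (ger0_norm t0).
rewrite normrM normrX (ger0_norm t0).
have s0 : 0 <= t ^+ 2 by rewrite exprn_ge0.
have s1 : t ^+ 2 <= 1 by rewrite exprn_ile1.
move: (t ^+ 2) s0 s1 (norm_sqsum_le w) (normr_ge0 (sqsum w)) w1 w2 => s s0 s1.
move: `|_| (sqnorm _) => a b ab a0 a1 b1; split.
  by apply: le_lt_trans a1; rewrite ler_piMl.
(* the value at s = 1, plus a remainder that is nonnegative term by term *)
rewrite -subr_gt0 (_ : _ - _ = (1 + a ^+ 2 - 2 * b) +
   (1 - s) * (2 * (b - a) + 2 * (a * (1 - a)) + (1 - s) * a ^+ 2)); last by ring.
rewrite ltr_pwDl ?subr_gt0// mulr_ge0 ?subr_ge0// !addr_ge0//.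
- by rewrite mulr_ge0 ?subr_ge0.
- by rewrite !mulr_ge0 ?subr_ge0// ltW.
by rewrite mulr_ge0 ?subr_ge0// exprn_ge0.
Qed.

Lemma continuous_real_complex : continuous (real_complex R : R -> C).
Proof.
move=> x; apply/cvgrPdist_lt => e e0.
(* a positive complex number is real *)
have [re re0 ee] : exists2 r : R, 0 < r & e = real_complex R r.
  move: e0; case: e => a b; rewrite ltcE /= => /andP[/eqP -> a0].
  by exists a.
rewrite ee; near=> y.
rewrite -rmorphB normc_def /= expr0n addr0 sqrtr_sqr ltcR.
by near: y; apply: cvgr_dist_lt.
Unshelve. all: by end_near. Qed.

Lemma connected_lie_ball m : connected (@lie_ball m).
Proof.
pose seg (w : 'rV[C]_m) := (fun t : R => real_complex R t *: w) @` `[0, 1].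
rewrite (_ : @lie_ball m = \bigcup_(w in @lie_ball m) seg w); last first.
  apply/seteqP; split => [w Ww|_ [w Ww [t /= t01 <-]]].
    exists w => //; exists 1; first by rewrite /= in_itv/= ler01 lexx.
    by rewrite (rmorph1 (real_complex R)) scale1r.
  move: t01; rewrite in_itv/= => /andP[t0 t1].
  apply: lie_ball_star => //; first by rewrite ler0c.
  by rewrite -(rmorph1 (real_complex R)) lecR.
apply: bigcup_connected.
  exists 0 => w Ww; exists 0 => /=; first by rewrite in_itv/= lexx ler01.
  by rewrite scale0r.
move=> w Ww; apply: connected_continuous_connected.
  exact/connected_intervalP/interval_is_interval.
apply: continuous_subspaceT => t.
apply: cvgZr_tmp; exact: continuous_real_complex.
Qed.

End Domains.

(** * Positive lines of a form of signature (1, m) *)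

Section Charts.
Variable R : realType.
Local Notation C := (Cplx R).

(** For a single row A, the matrix 1 - A A^* is the number 1 - |A|^2. *)
Lemma type_I_ball m : @type_I R 1 m = @complex_ball R m.
Proof.
have formE (A : 'M[C]_(1, m)) (v : 'rV[C]_1) :
    form (@Num.conj C) (1%:M - A *m (mxconj A)^T) v v = `|v 0 0| ^+ 2 * (1 - sqnorm A).
  rewrite /form mxE big_ord1 !mxE big_ord1 !mxE /= mulr1n normCK.
  rewrite mulrAC; congr (_ * (_ - _)).
  by apply: eq_bigr => i _; rewrite !mxE normCK.
apply/seteqP; split => A; rewrite /type_I /complex_ball /= /posdef -/(sqnorm A).
  move=> /(_ 1%:M (oner_neq0 _)); rewrite formE !mxE normr1 expr1n mul1r.
  by rewrite subr_gt0.
move=> A1 v v0; rewrite formE mulr_gt0 ?subr_gt0// exprn_gt0// normr_gt0.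
by apply: contra_neq v0 => v0; apply/rowP => i; rewrite ord1 v0 mxE.
Qed.

Section Ball.
(* The rows of B are m negative vectors followed by a positive one; the right
   inverse K reads off the coordinates of a vector in this basis. *)
Variables (n m : nat) (B : 'M[C]_(m + 1, n)) (K : 'M[C]_(n, m + 1)).
Hypothesis BK : B *m K = 1%:M.

Definition ball_cone : set 'rV[C]_n :=
  [set v | exists2 c : 'rV[C]_(m + 1), v = c *m B &
     sqnorm (lsubmx c) < sqnorm (rsubmx c)].

Lemma cone_invariant_ball : cone_invariant ball_cone.
Proof.
move=> a _ a0 [c -> lc]; exists (a *: c); first by rewrite -scalemxAl.
by rewrite !linearZ /= !sqnormZ ltr_pM2l// exprn_gt0// normr_gt0.
Qed.

(** A positive vector has a nonzero positive coordinate z, and dividing by z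
    turns |w|^2 < |z|^2 into the inequality of the unit ball. *)
Theorem ball_chart :
  biholomorphic (proj_of ball_cone : set (projective R n)) (@complex_ball R m).
Proof.
pose s (w : 'rV[C]_m) : 'rV[C]_n := row_mx w 1%:M *m B.
have sK w : s w *m K = row_mx w 1%:M by rewrite /s -mulmxA BK mulmx1.
apply: (@chart_biholomorphic R n m (rsubmx K) (lsubmx K) s).
- move=> w.
  have d1 : differentiable (fun w : 'rV[C]_m => row_mx w (1%:M : 'rV[C]_1)) w.
    exact: (differentiable_row_mx (differentiable_id w) (differentiable_cst _ w)).
  exact: (differentiable_comp d1 (differentiable_linear_row (mulmxr B) _)).
- by move=> w; rewrite mulmx_rsub sK row_mxKr mxE.
- by move=> w; rewrite mulmx_lsub sK row_mxKl.
- exact: cone_invariant_ball.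
- move=> _ [c -> lc].
  set a := rsubmx c 0 0.
  have na : sqnorm (rsubmx c) = `|a| ^+ 2 by rewrite /sqnorm big_ord1.
  move: lc; rewrite na => lc.
  have a0 : a != 0.
    by apply: contraTneq lc => ->; rewrite normr0 expr0n /= (le_gtF (sqnorm_ge0 _)).
  exists a, (a^-1 *: lsubmx c); split=> //.
    rewrite /complex_ball /= -/(sqnorm _) sqnormZ normfV exprVn.
    by rewrite mulrC ltr_pdivrMr ?mul1r// exprn_gt0// normr_gt0.
  rewrite /s scalemxAl scale_row_mx scalerA mulfV// scale1r scalemx1.
  by rewrite /a -mx11_scalar hsubmxK.
- move=> w ww; exists (row_mx w 1%:M) => //.
  by rewrite row_mxKl row_mxKr {2}/sqnorm big_ord1 mxE normr1 expr1n.
Qed.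

End Ball.

(** * Positive isotropic lines of a form of signature (2, m) *)

Section Quadric.
(* Here the rows of B are m negative vectors followed by two positive ones. *)
Variables (n m : nat) (B : 'M[C]_(m + 2, n)) (K : 'M[C]_(n, m + 2)).
Hypothesis BK : B *m K = 1%:M.

Definition quadric_cone : set 'rV[C]_n :=
  [set v | exists c : 'rV[C]_(m + 2),
     [/\ v = c *m B, sqsum (rsubmx c) = sqsum (lsubmx c) &
         sqnorm (lsubmx c) < sqnorm (rsubmx c)]].

(** With u and v the two isotropic coordinates, this is the condition
    |v| < |u|; - j in place of j gives the opposite condition. *)
Definition half_cone (j : C) : set 'rV[C]_n :=
  [set v | `|iso2 j (rsubmx (v *m K))| < `|iso1 j (rsubmx (v *m K))|].

Lemma cone_invariant_quadric : cone_invariant quadric_cone.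
Proof.
move=> a _ a0 [c [-> qc lc]]; exists (a *: c); split; first by rewrite -scalemxAl.
  by rewrite !linearZ /= !sqsumZ qc.
by rewrite !linearZ /= !sqnormZ ltr_pM2l// exprn_gt0// normr_gt0.
Qed.

Lemma cone_invariant_half j : cone_invariant (half_cone j).
Proof.
move=> a v a0; rewrite /half_cone /= -scalemxAl linearZ /= iso1Z iso2Z.
by rewrite !normrM ltr_pM2l// normr_gt0.
Qed.

Lemma open_half_cone j : open (half_cone j).
Proof.
have ck (k : 'cV[C]_n) : continuous (fun v : 'rV[C]_n => (v *m k) 0 0).
  by move=> v; exact/differentiable_continuous/differentiable_denom.
have c1 i : continuous (fun v : 'rV[C]_n => iso1 i (rsubmx (v *m K))).
  rewrite (_ : (fun _ => _) = (fun v => (v *m (rsubmx K *m iso1_mx i)) 0 0)) //.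
  by apply/funext => v; rewrite mulmxA mul_iso1_mx mulmx_rsub.
have c2 : continuous (fun v : 'rV[C]_n => iso2 j (rsubmx (v *m K))).
  rewrite (_ : (fun _ => _) = (fun v : 'rV[C]_n => iso1 (- j) (rsubmx (v *m K)))) //.
  by apply/funext => v; rewrite iso1N.
have rn (f : 'rV[C]_n -> C) v : `|f v| \is Num.real by rewrite normr_real.
exact: (open_lt_real (continuous_normr c2) (continuous_normr (c1 j)) (rn _) (rn _)).
Qed.

(** On the locus |u| = |v|, the equation u v = w.w gives |u|^2 <= |w|^2,
    whereas positivity says |w|^2 < (|u|^2 + |v|^2) / 2 = |u|^2. *)
Lemma quadric_cone_half j : j ^+ 2 = -1 ->
  quadric_cone `<=` half_cone j `|` half_cone (- j).
Proof.
move=> j2 _ [c [-> qc lc]]; rewrite /half_cone /= -mulmxA BK mulmx1.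
rewrite iso1N iso2N.
have := iso_mul j2 (rsubmx c); have := iso_sqnorm j2 (rsubmx c).
move: (iso1 _ _) (iso2 _ _) => u v uv2 uv.
case: (real_ltgtP (normr_real u) (normr_real v)) => [h|h|E]; [by right|by left|].
have rE : sqnorm (rsubmx c) = `|u| ^+ 2.
  apply: (mulfI (_ : 2 != 0 :> C)); first by rewrite pnatr_eq0.
  by rewrite -uv2 -E; ring.
have := norm_sqsum_le (lsubmx c); rewrite -qc -uv normrM -E -expr2 -rE.
by move=> /(lt_le_trans lc); rewrite ltxx.
Qed.

Lemma half_cone_disjoint j : half_cone j `&` half_cone (- j) = set0.
Proof.
apply/seteqP; split => // v [].
rewrite /half_cone /= iso1N iso2N.
by move=> /lt_trans h /h; rewrite ltxx.
Qed.

Variable j : C.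
Hypothesis j2 : j ^+ 2 = -1.

(** Once u is scaled to 1, the quadratic equation u v = w.w determines v, so
    that w alone parametrises the half |v| < |u| of the quadric. *)
Definition quadric_section (w : 'rV[C]_m) : 'rV[C]_n :=
  row_mx w (of_iso j 1 (sqsum w)) *m B.

Lemma quadric_sectionK w : quadric_section w *m K = row_mx w (of_iso j 1 (sqsum w)).
Proof. by rewrite /quadric_section -mulmxA BK mulmx1. Qed.

Lemma quadric_section_norm w :
  (quadric_section w *m (rsubmx K *m iso1_mx j)) 0 0 = 1.
Proof. by rewrite mulmxA mul_iso1_mx mulmx_rsub quadric_sectionK row_mxKr iso1_of. Qed.

Lemma quadric_section_neq0 w : quadric_section w != 0.
Proof.
apply: contra_eq_neq (quadric_section_norm w) => ->.
by rewrite mul0mx mxE eq_sym oner_eq0.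
Qed.

Lemma differentiable_quadric_section w : differentiable quadric_section w.
Proof.
have dsq : differentiable (@sqsum C m) w.
  apply: differentiable_fsum => i.
  exact: (differentiableX 1 (differentiable_coord _ _ _)).
have d2 : differentiable (fun w : 'rV[C]_m => of_iso j 1 (sqsum w)) w.
  apply: differentiable_row => i; rewrite (_ : (fun _ => _) =
    if i == 0 then 2^-1 *: (cst 1 + @sqsum C m)
    else (2 * j)^-1 *: (cst 1 - @sqsum C m)); last first.
    by apply/funext => v; rewrite mxE; case: ifP => _; rewrite mulrC.
  by case: ifP => _; apply: differentiableZ;
    [apply: differentiableD|apply: differentiableB] => //; exact: differentiable_cst.
have d1 : differentiable (fun w : 'rV[C]_m => row_mx w (of_iso j 1 (sqsum w))) w.
  exact: (differentiable_row_mx (differentiable_id w) d2).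
exact: (differentiable_comp d1 (differentiable_linear_row (mulmxr B) _)).
Qed.

Lemma quadric_section_mem w : lie_ball w ->
  (quadric_cone `&` half_cone j) (quadric_section w).
Proof.
move=> [w1 w2]; split; last first.
  by rewrite /half_cone /= quadric_sectionK row_mxKr iso1_of// iso2_of// normr1.
exists (row_mx w (of_iso j 1 (sqsum w))).
rewrite row_mxKl row_mxKr -(iso_mul j2) iso1_of// iso2_of// mul1r; split=> //.
rewrite -(ltr_pM2l (ltr0n _ 2)) -(iso_sqnorm j2) iso1_of// iso2_of//.
by rewrite normr1 expr1n.
Qed.

(** Dividing by u turns v into v / u = (w / u).(w / u), and the inequality
    2 |w|^2 < |u|^2 + |v|^2 into that of the Lie ball. *)
Lemma quadric_section_surj v : (quadric_cone `&` half_cone j) v ->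
  exists a w, [/\ a != 0, lie_ball w & v = a *: quadric_section w].
Proof.
move=> [[c [-> qc lc]]]; rewrite /half_cone /= -mulmxA BK mulmx1.
have := iso_mul j2 (rsubmx c); have := iso_sqnorm j2 (rsubmx c).
have := of_iso_eq j2 (rsubmx c).
move: (iso1 _ _) (iso2 _ _) => u v' E uv2 uv lt_uv.
have u0 : u != 0.
  by rewrite -normr_gt0; apply: le_lt_trans lt_uv; exact: normr_ge0.
exists u, (u^-1 *: lsubmx c).
have sE : sqsum (u^-1 *: lsubmx c) = v' / u.
  by rewrite sqsumZ -qc -uv; field.
split=> //.
- rewrite /lie_ball/= sE sqnormZ normf_div; split.
    by rewrite ltr_pdivrMr ?normr_gt0// mul1r.
  rewrite normfV -(ltr_pM2l (_ : 0 < `|u| ^+ 2)) ?exprn_gt0 ?normr_gt0//.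
  have nu0 : `|u| != 0 by rewrite normr_eq0.
  rewrite (_ : _ * (2 * _) = 2 * sqnorm (lsubmx c)); last by field.
  rewrite (_ : _ * (1 + _) = `|u| ^+ 2 + `|v'| ^+ 2); last by field.
  by rewrite uv2 ltr_pM2l.
- rewrite /quadric_section scalemxAl; congr (_ *m _).
  rewrite sE scale_row_mx scalerA mulfV// scale1r of_isoZ mulr1.
  by rewrite mulrC divfK// E hsubmxK.
Qed.

Theorem quadric_chart : biholomorphic
  (proj_of (quadric_cone `&` half_cone j) : set (projective R n)) (@lie_ball R m).
Proof.
apply: (@chart_biholomorphic R n m (rsubmx K *m iso1_mx j) (lsubmx K) quadric_section).
- exact: differentiable_quadric_section.
- exact: quadric_section_norm.
- by move=> w; rewrite mulmx_lsub quadric_sectionK row_mxKl.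
- exact: (cone_invariantI cone_invariant_quadric (@cone_invariant_half j)).
- exact: quadric_section_surj.
- exact: quadric_section_mem.
Qed.

Lemma connected_quadric :
  connected (proj_of (quadric_cone `&` half_cone j) : set (projective R n)).
Proof.
rewrite -(section_image quadric_section_neq0 quadric_section_surj quadric_section_mem).
apply: connected_continuous_connected; first exact: connected_lie_ball.
apply: continuous_subspaceT; apply: section_line_continuous.
exact: differentiable_quadric_section.
Qed.

End Quadric.

End Charts.

(** A connected subset of D through x cannot meet both of the disjoint open
    sets U and V that cover D. *)
Lemma connected_component_split (T : topologicalType) (D U V : set T) x :
  open U -> open V -> D `<=` U `|` V -> U `&` V = set0 ->
  connected (D `&` U) -> (D `&` U) x ->
  connected_component D x = D `&` U.
Proof.
move=> oU oV DUV UV0 cU [Dx Ux]; apply/seteqP; split; last first.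
  by apply: connected_component_max => // y [].
set A := connected_component D x.
have AD : A `<=` D by exact: connected_component_sub.
have <- : A `&` U = A.
  apply: (@component_connected _ D x) => //.
  - by exists x; split => //; exact: connected_component_refl.
  - by exists U.
  - exists (~` V); first by rewrite closedC.
    apply/seteqP; split => y [Ay]; [move=> Uy|move=> nV]; split => //.
      by move=> Vy; have : (U `&` V) y by []; rewrite UV0.
    by have [] := DUV _ (AD _ Ay).
by move=> y [/AD].
Qed.

(** * Orthogonal bases and signatures of Hermitian forms *)

Section Hermitian.
Variable C : numClosedFieldType.
Variable n : nat.
Variable G : 'M[C]_n.
Hypothesis Gsym : G^T = G.
Hypothesis Greal : mxconj G = G.

Definition herm (u v : 'rV[C]_n) : C := (u *m G *m (mxconj v)^T) 0 0.

Lemma mxconjD p m (A B : 'M[C]_(p, m)) : mxconj (A + B) = mxconj A + mxconj B.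
Proof. exact: map_mxD. Qed.

Lemma mxconjZ p m a (A : 'M[C]_(p, m)) : mxconj (a *: A) = Num.conj a *: mxconj A.
Proof. exact: map_mxZ. Qed.

Lemma mxconjK p m (A : 'M[C]_(p, m)) : mxconj (mxconj A) = A.
Proof. by apply/matrixP => i j; rewrite !mxE conjCK. Qed.

Lemma mxconj_trK p m (A : 'M[C]_(p, m)) : mxconj (mxconj A)^T = A^T.
Proof. by apply/matrixP => i j; rewrite !mxE conjCK. Qed.

Lemma mxconjM p m k (A : 'M[C]_(p, m)) (B : 'M[C]_(m, k)) :
  mxconj (A *m B) = mxconj A *m mxconj B.
Proof. exact: map_mxM. Qed.

Lemma hermDl u v w : herm (u + v) w = herm u w + herm v w.
Proof. by rewrite /herm !mulmxDl mxE. Qed.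

Lemma hermZl a u w : herm (a *: u) w = a * herm u w.
Proof. by rewrite /herm -!scalemxAl mxE. Qed.

Lemma hermC u v : herm v u = Num.conj (herm u v).
Proof.
have -> : Num.conj (herm u v) = (mxconj (u *m G *m (mxconj v)^T)) 0 0 by rewrite mxE.
rewrite !mxconjM Greal mxconj_trK.
rewrite /herm -[v *m G *m _]trmxK mxE; congr (_ 0 0).
by rewrite !trmx_mul trmxK Gsym mulmxA.
Qed.

Lemma hermDr u v w : herm u (v + w) = herm u v + herm u w.
Proof. by rewrite hermC hermDl rmorphD /= -!hermC. Qed.

Lemma hermZr a u w : herm u (a *: w) = Num.conj a * herm u w.
Proof. by rewrite hermC hermZl rmorphM /= -hermC. Qed.

Lemma herm0l u : herm 0 u = 0.
Proof. by rewrite /herm !mul0mx mxE. Qed.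

Lemma herm0r u : herm u 0 = 0.
Proof. by rewrite hermC herm0l rmorph0. Qed.

Lemma herm_suml I (r : seq I) (F : I -> 'rV[C]_n) w :
  herm (\sum_(i <- r) F i) w = \sum_(i <- r) herm (F i) w.
Proof.
by elim/big_rec2: _ => [|i x y _ <-]; rewrite ?herm0l// hermDl.
Qed.

Lemma herm_sumr I (r : seq I) (F : I -> 'rV[C]_n) w :
  herm w (\sum_(i <- r) F i) = \sum_(i <- r) herm w (F i).
Proof.
by elim/big_rec2: _ => [|i x y _ <-]; rewrite ?herm0r// hermDr.
Qed.

Lemma herm_conj u v : herm (mxconj u) (mxconj v) = Num.conj (herm u v).
Proof.
have -> : Num.conj (herm u v) = (mxconj (u *m G *m (mxconj v)^T)) 0 0 by rewrite mxE.
rewrite !mxconjM Greal mxconj_trK /herm; congr ((_ *m _) 0 0).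
by rewrite mxconjK.
Qed.

Lemma herm_real v : herm v v \is Num.real.
Proof. by apply/CrealP; rewrite -hermC. Qed.

Definition orthogonal_seq (s : seq 'rV[C]_n) :=
  {in s &, forall u v, u != v -> herm u v = 0}.

Lemma pairwise_herm s : uniq s ->
  pairwise (fun u v => herm u v == 0) s <-> orthogonal_seq s.
Proof.
elim: s => [|v s IH] //= /andP[vs us]; split.
  move=> /andP[/allP vo /(IH us) so] x y; rewrite !inE.
  move=> /orP[/eqP ->|xs] /orP[/eqP ->|ys]; rewrite ?eqxx//.
  - by move=> _; apply/eqP/vo.
  - by move=> _; rewrite hermC (eqP (vo _ xs)) rmorph0.
  - exact: so.
move=> so; apply/andP; split.
  apply/allP => x xs; apply/eqP/so; rewrite ?inE ?eqxx ?xs ?orbT//.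
  by apply: contraNneq vs => ->.
by apply/IH => // x y xs ys; apply: so; rewrite inE ?xs ?ys orbT.
Qed.

(** The coordinates of a vector in an orthogonal family are read off by
    pairing it with the members of the family. *)
Lemma orthogonal_span s v : free s -> orthogonal_seq s -> v \in span s ->
  exists c : 'rV[C]_n -> C, v = \sum_(x <- s) c x *: x /\
    forall y, y \in s -> herm v y = c y * herm y y.
Proof.
move=> fs so vs; have [c cE _] := free_span fs vs; exists c; split => // y ys.
rewrite cE herm_suml (bigD1_seq y) ?free_uniq//= big1_seq ?addr0 ?hermZl//.
by move=> x /andP[xy xs]; rewrite hermZl so ?mulr0.
Qed.

Lemma orthogonal_span_norm s v : free s -> orthogonal_seq s -> v \in span s ->
  exists c : 'rV[C]_n -> C, v = \sum_(x <- s) c x *: x /\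
    herm v v = \sum_(x <- s) `|c x| ^+ 2 * herm x x.
Proof.
move=> fs so vs; have [c [cE hc]] := orthogonal_span fs so vs; exists c.
split => //; rewrite {2}cE herm_sumr !big_seq; apply: eq_bigr => x xs.
by rewrite hermZr hc// mulrA normCK [Num.conj _ * _]mulrC.
Qed.

Lemma span_pos s v : free s -> orthogonal_seq s -> {in s, forall x, 0 < herm x x} ->
  v \in span s -> herm v v <= 0 -> v = 0.
Proof.
move=> fs so sp vs; have [c [cE ->]] := orthogonal_span_norm fs so vs => h.
have pos x : x \in s -> 0 <= `|c x| ^+ 2 * herm x x.
  by move=> xs; rewrite mulr_ge0 ?exprn_ge0// ltW// sp.
rewrite cE big_seq big1// => x xs.
have : `|c x| ^+ 2 * herm x x <= 0.
  apply: le_trans h; rewrite (big_rem x)//= lerDl big_seq sumr_ge0// => y.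
  by move=> /mem_rem; exact: pos.
by rewrite pmulr_lle0 ?sp// -normrX normr_le0 expf_eq0 /= => /eqP ->; rewrite scale0r.
Qed.

Lemma span_neg s v : free s -> orthogonal_seq s -> {in s, forall x, herm x x < 0} ->
  v \in span s -> herm v v <= 0.
Proof.
move=> fs so sp vs; have [c [cE ->]] := orthogonal_span_norm fs so vs.
rewrite big_seq sumr_le0// => x xs.
by rewrite mulr_ge0_le0 ?exprn_ge0// ltW// sp.
Qed.

(** Pairwise orthogonality in a fixed order of the basis amounts, by Hermitian
    symmetry, to orthogonality of all pairs of distinct vectors. *)
Lemma signatureP (U : {vspace 'rV[C]_n}) p r : has_signature U herm p r <->
  exists X Y : seq 'rV[C]_n,
    [/\ size X = p, size Y = r, basis_of U (X ++ Y) & orthogonal_seq (X ++ Y)] /\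
    ({in X, forall v, 0 < herm v v} /\ {in Y, forall v, herm v v < 0}).
Proof.
split=> -[X [Y]]; last first.
  move=> [[sX sY bXY o] [pX nY]]; exists X, Y; split => //.
  split; [|exact/allP|exact/allP].
  by apply/pairwise_herm => //; exact/free_uniq/basis_free/bXY.
move=> [sX sY bXY [ort /allP pX /allP nY]]; exists X, Y; split => //; split => //.
by apply/pairwise_herm => //; exact/free_uniq/basis_free/bXY.
Qed.

Lemma orthogonal_catl X Y : orthogonal_seq (X ++ Y) -> orthogonal_seq X.
Proof. by move=> o x y xs ys; apply: o; rewrite mem_cat ?xs ?ys. Qed.

Lemma orthogonal_catr X Y : orthogonal_seq (X ++ Y) -> orthogonal_seq Y.
Proof. by move=> o x y xs ys; apply: o; rewrite mem_cat ?xs ?ys orbT. Qed.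

(** One half of Sylvester's law of inertia.  The span of the positive vectors of
    the first basis meets the span of the negative vectors of the second one
    trivially, so p + r' is at most the dimension p' + r'. *)
Lemma signature_le (U : {vspace 'rV[C]_n}) p r p' r' :
  has_signature U herm p r -> has_signature U herm p' r' -> (p <= p')%N.
Proof.
move=> /signatureP[X [Y [[sX sY b o] [pX nY]]]].
move=> /signatureP[X' [Y' [[sX' sY' b' o'] [pX' nY']]]].
have fX := catl_free (basis_free b); have fY' := catr_free (basis_free b').
have dU : \dim U = (p' + r')%N.
  rewrite -sX' -sY' -size_cat.
  exact: (size_basis (n := size (X' ++ Y')) (X := in_tuple _) b').
have XY0 : (<<X>> :&: <<Y'>> = 0)%VS.
  apply/eqP; rewrite -subv0; apply/subvP => v /memv_capP[vX vY].
  rewrite memv0; apply/eqP/(span_pos fX (orthogonal_catl o) pX vX).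
  exact: (span_neg fY' (orthogonal_catr o') nY' vY).
have : (\dim (<<X>> + <<Y'>>) <= \dim U)%N.
  apply: dimvS; rewrite subv_add; apply/andP; split.
    by rewrite -(span_basis b) span_cat addvSl.
  by rewrite -(span_basis b') span_cat addvSr.
by rewrite dimv_disjoint_sum// (eqP fX) (eqP fY') sX sY' dU leq_add2r.
Qed.

Lemma signature_unique (U : {vspace 'rV[C]_n}) p r p' r' :
  has_signature U herm p r -> has_signature U herm p' r' -> p = p'.
Proof.
by move=> h h'; apply/eqP; rewrite eqn_leq (signature_le h h') (signature_le h' h).
Qed.

Definition nondegenerate_on (U : {vspace 'rV[C]_n}) :=
  forall u, u \in U -> (forall v, v \in U -> herm u v = 0) -> u = 0.

Lemma signature_nondegenerate U p r :
  has_signature U herm p r -> nondegenerate_on U.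
Proof.
move=> /signatureP[X [Y [[_ _ b ort] [pX nY]]]] u; rewrite -(span_basis b) => us hu.
have [c [uE hc]] := orthogonal_span (basis_free b) ort us.
rewrite uE big_seq big1// => x xs; have := hc _ xs.
rewrite hu ?memv_span// => /esym/eqP; rewrite mulf_eq0 => /orP[/eqP ->|].
  by rewrite scale0r.
by move: xs; rewrite mem_cat => /orP[/pX|/nY] h; rewrite ?(gt_eqF h) ?(lt_eqF h).
Qed.

Definition real_vec (v : 'rV[C]_n) := mxconj v == v.

Lemma real_vecD u v : real_vec u -> real_vec v -> real_vec (u + v).
Proof. by rewrite /real_vec mxconjD => /eqP -> /eqP ->. Qed.

(** If all real vectors of U were isotropic, polarisation would make the form
    vanish on pairs of real vectors; these span U over C, as U is stable under
    conjugation, so the form would vanish on U. *)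
Lemma exists_real_anisotropic (U : {vspace 'rV[C]_n}) :
  (forall v, v \in U -> mxconj v \in U) -> nondegenerate_on U -> U != 0%VS ->
  exists v, [/\ v \in U, real_vec v & herm v v != 0].
Proof.
move=> cU nU; apply: contra_neqP => nov.
have iso v : v \in U -> real_vec v -> herm v v = 0.
  move=> vU rv; apply/eqP; apply: contrapT => /negP h.
  by apply: nov; exists v.
have orth u v : u \in U -> v \in U -> real_vec u -> real_vec v -> herm u v = 0.
  move=> uU vU ru rv; have := iso _ (rpredD uU vU) (real_vecD ru rv).
  rewrite hermDl !hermDr (iso u)// (iso v)// add0r addr0.
  rewrite -[herm v u]conjCK -hermC -herm_conj (eqP ru) (eqP rv) -mulr2n => /eqP.
  by rewrite mulrn_eq0 => /eqP.
have split_real v : v \in U -> exists a b, [/\ a \in U, b \in U, real_vec a,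
    real_vec b & v = a + 'i *: b].
  move=> vU; exists (2^-1 *: (v + mxconj v)), ((2 * 'i)^-1 *: (v - mxconj v)).
  have i0 : 'i != 0 :> C by exact: neq0Ci.
  split.
  - by rewrite rpredZ ?rpredD ?cU.
  - by rewrite rpredZ ?rpredB ?cU.
  - rewrite /real_vec mxconjZ mxconjD mxconjK addrC.
    by rewrite fmorphV rmorph_nat.
  - rewrite /real_vec mxconjZ mxconjD -scaleN1r mxconjZ mxconjK.
    rewrite rmorphN1 scaleN1r fmorphV rmorphM /= rmorph_nat conjCi mulrN invrN.
    by rewrite scaleNr -scalerN scaleN1r opprB.
  by apply/rowP => k; rewrite !mxE; field.
apply/eqP; rewrite -subv0; apply/subvP => u uU; rewrite memv0; apply/eqP.
apply: nU => // v vU.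
have [a [b [aU bU ra rb ->]]] := split_real _ uU.
have [a' [b' [a'U b'U ra' rb' ->]]] := split_real _ vU.
by rewrite hermDl !hermDr !hermZl !hermZr !orth// !mulr0 !addr0.
Qed.

(** Split off a real anisotropic vector v: as v is real, its orthogonal
    complement in U is again stable under conjugation, and the form is still
    nondegenerate on it. *)
Lemma real_orthogonal_basis (U : {vspace 'rV[C]_n}) :
  (forall v, v \in U -> mxconj v \in U) -> nondegenerate_on U ->
  exists s, [/\ basis_of U s, orthogonal_seq s, all real_vec s &
     {in s, forall v, herm v v != 0}].
Proof.
have [k] := ubnP (\dim U); elim: k U => // k IH U dU cU nU.
have [->|U0] := eqVneq U 0%VS.
  by exists [::]; split => //; exact: nil_basis.
have [v [vU rv hv]] := exists_real_anisotropic cU nU U0.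
pose L := linfun (mulmxr (G *m (mxconj v)^T) : 'rV[C]_n -> 'rV[C]_1).
pose U' := (U :&: lker L)%VS.
have memU' u : (u \in U') = (u \in U) && (herm u v == 0).
  rewrite memv_cap memv_ker lfunE /= mulmxA; congr (_ && _).
  apply/eqP/eqP => [h|h]; first by rewrite /herm h mxE.
  by apply/rowP => i; rewrite ord1 [RHS]mxE; exact: h.
have vU' : v \notin U' by rewrite memU' (negbTE hv) andbF.
have U'U : (U' <= U)%VS by exact: capvSl.
have dU' : (\dim U' < \dim U)%N.
  rewrite ltn_neqAle dimvS// andbT; apply: contra vU' => /eqP dd.
  by rewrite (_ : U' = U)//; apply/eqP; rewrite eqEdim U'U dd leqnn.
have decomp w : w \in U -> exists a, w - a *: v \in U'.
  move=> wU; exists (herm w v / herm v v).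
  rewrite memU' rpredB ?rpredZ//= -scaleNr hermDl hermZl mulNr divfK//.
  by rewrite subrr.
have [s [bs os rs ns]] : exists s, [/\ basis_of U' s, orthogonal_seq s,
    all real_vec s & {in s, forall v, herm v v != 0}].
  apply: IH; first exact: leq_trans dU' dU.
    move=> u; rewrite !memU' => /andP[uU /eqP h]; rewrite cU//=.
    by rewrite -(eqP rv) herm_conj h rmorph0.
  move=> u uU' hu; apply: nU; first exact: (subvP U'U).
  move=> w /decomp[a wU']; rewrite -(subrK (a *: v) w) hermDr hu// add0r.
  by rewrite hermZr; move: uU'; rewrite memU' => /andP[_ /eqP ->]; rewrite mulr0.
have sv x : x \in s -> herm x v = 0.
  by move=> /(basis_mem bs); rewrite memU' => /andP[_ /eqP].
exists (v :: s); split.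
- rewrite /basis_of span_cons free_cons (span_basis bs) vU' (basis_free bs) andbT.
  rewrite eqEsubv subv_add U'U andbT -memvE vU /=; apply/subvP => w /decomp[a h].
  by rewrite -(subrK (a *: v) w) addrC memv_add// memvZ// memv_line.
- move=> x y; rewrite !inE => /orP[/eqP ->|xs] /orP[/eqP ->|ys]; rewrite ?eqxx//.
  + by rewrite hermC sv// rmorph0.
  + by rewrite sv.
  + exact: os.
- by rewrite /= rv.
- by move=> x; rewrite inE => /orP[/eqP ->//|]; exact: ns.
Qed.

(** The basis of real vectors need not be the one that the signature was
    computed from; Sylvester's law says that it has as many positive vectors. *)
Lemma real_signature (U : {vspace 'rV[C]_n}) p r :
  (forall v, v \in U -> mxconj v \in U) -> has_signature U herm p r ->
  exists X Y : seq 'rV[C]_n,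
    [/\ size X = p, basis_of U (X ++ Y), orthogonal_seq (X ++ Y) &
        all real_vec (X ++ Y)] /\
    ({in X, forall v, 0 < herm v v} /\ {in Y, forall v, herm v v < 0}).
Proof.
move=> cU sU; have nU := signature_nondegenerate sU.
have [s [bs os rs ns]] := real_orthogonal_basis cU nU.
pose pos v := 0 < herm v v.
pose X := [seq v <- s | pos v]; pose Y := [seq v <- s | predC pos v].
have sXY : perm_eq (X ++ Y) s by rewrite perm_filterC.
have o : orthogonal_seq (X ++ Y).
  by move=> x y; rewrite !(perm_mem sXY); exact: os.
have b : basis_of U (X ++ Y) by rewrite (perm_basis _ sXY).
have pX : {in X, forall v, 0 < herm v v} by move=> v; rewrite mem_filter => /andP[].
have nY : {in Y, forall v, herm v v < 0}.
  move=> v; rewrite mem_filter => /andP[/= h vs].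
  by rewrite real_ltNge ?herm_real ?real0// le_eqVlt eq_sym (negbTE (ns _ vs)).
exists X, Y; split => //; split => //; last by rewrite (perm_all _ sXY).
have : has_signature U herm (size X) (size Y) by apply/signatureP; exists X, Y.
by move=> /signature_unique; apply; exact: sU.
Qed.

End Hermitian.

(** * Orthonormal frames *)

Section Frame.
Variables (C : numClosedFieldType) (n m p : nat).
Variable G : 'M[C]_n.
Hypothesis Gsym : G^T = G.
Hypothesis Greal : mxconj G = G.
Local Notation H := (herm G).

(** Negative vectors come first, so that block decompositions of coordinates
    read (w, z) with w negative and z positive. *)
Definition split_sign : 'M[C]_(m + p) := block_mx (- 1%:M) 0 0 1%:M.

Lemma split_signK : split_sign *m split_sign = 1%:M.
Proof.
rewrite /split_sign mulmx_block !mulmx0 !mul0mx !addr0 add0r mulNmx mulmxN opprK.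
by rewrite !mulmx1 -scalar_mx_block.
Qed.

(** Each vector is divided by the square root of |h(v, v)|.  This factor is
    real, so that real vectors stay real. *)
Lemma normalized_frame (U : {vspace 'rV[C]_n}) X Y :
  size X = p -> size Y = m -> basis_of U (X ++ Y) -> orthogonal_seq G (X ++ Y) ->
  {in X, forall v, 0 < H v v} -> {in Y, forall v, H v v < 0} ->
  exists B : 'M[C]_(m + p, n),
    [/\ forall v, v \in U <-> (exists c, v = c *m B),
        B *m G *m (mxconj B)^T = split_sign &
        all (@real_vec C n) (X ++ Y) -> mxconj B = B].
Proof.
move=> sX sY bXY ort pX nY.
pose s := Y ++ X; have ss : size s = (m + p)%N by rewrite size_cat sX sY.
have sXY : perm_eq s (X ++ Y) by rewrite /s perm_catC.
have us : uniq s by rewrite (perm_uniq sXY) free_uniq// (basis_free bXY).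
have bs : basis_of U s by rewrite (perm_basis _ sXY).
have os : orthogonal_seq G s by move=> x y; rewrite !(perm_mem sXY); exact: ort.
have mem i : s`_(nat_of_ord (i : 'I_(m + p))) \in s by rewrite mem_nth// ss.
pose a v := (sqrtC `|H v v|)^-1.
have Hs0 v : v \in s -> H v v != 0.
  by rewrite mem_cat => /orP[/nY|/pX] h; rewrite ?(lt_eqF h) ?(gt_eqF h).
have a0 v : v \in s -> a v != 0.
  by move=> /Hs0 h; rewrite invr_eq0 sqrtC_eq0 normr_eq0.
have aR v : Num.conj (a v) = a v.
  by rewrite geC0_conj// invr_ge0 sqrtC_ge0.
have aa v : a v * a v = `|H v v|^-1 by rewrite -expr2 exprVn sqrtCK.
pose B : 'M[C]_(m + p, n) := \matrix_(i < m + p) (a s`_i *: s`_i).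
exists B; split.
- have UE : U = limg (linfun (mulmxr B : 'rV[C]_(m + p) -> 'rV[C]_n)).
    apply/eqP; rewrite eqEsubv -{1}(span_basis bs); apply/andP; split.
      apply/span_subvP => x xs; apply/memv_imgP.
      have xi : (index x s < m + p)%N by rewrite -ss index_mem.
      exists ((a x)^-1 *: delta_mx 0 (Ordinal xi)); first exact: memvf.
      rewrite lfunE /= -scalemxAl -rowE rowK /= nth_index// scalerA mulVf ?a0//.
      by rewrite scale1r.
    apply/subvP => _ /memv_imgP[c _ ->]; rewrite lfunE /= mulmx_sum_row.
    by apply: memv_suml => i _; rewrite rowK !memvZ// (basis_mem bs).
  move=> v; rewrite UE; split.
    by move=> /memv_imgP[c _ ->]; exists c; rewrite lfunE.
  by move=> [c ->]; apply/memv_imgP; exists c; rewrite ?memvf ?lfunE.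
- have entry i k : (B *m G *m (mxconj B)^T) i k = H (row i B) (row k B).
    rewrite /herm -row_mul [LHS]mxE [RHS]mxE; apply: eq_bigr => j _.
    by congr (_ * _); [rewrite [RHS]mxE|rewrite !mxE].
  have Hrow i k : H (row i B) (row k B) =
      if i == k then H s`_i s`_i / `|H s`_i s`_i| else 0.
    rewrite !rowK hermZl hermZr// aR mulrA; case: eqVneq => [->|ik].
      by rewrite aa mulrC.
    by rewrite os ?mulr0 ?mem// nth_uniq ?ss.
  have Yn (i : 'I_m) : H s`_(lshift p i) s`_(lshift p i) < 0.
    by apply: nY; rewrite nth_cat sY /= ltn_ord mem_nth ?sY.
  have Xp (i : 'I_p) : 0 < H s`_(rshift m i) s`_(rshift m i).
    by apply: pX; rewrite nth_cat sY /= ltnNge leq_addr/= addKn mem_nth ?sX.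
  apply/matrixP => i k; rewrite entry Hrow /split_sign.
  case: (split_ordP i) => i' ->; case: (split_ordP k) => k' ->.
  - rewrite block_mxEul eq_lshift !mxE; case: eqP => _; rewrite ?oppr0//.
    by rewrite ltr0_norm// invrN mulrN mulfV// lt_eqF.
  - by rewrite block_mxEur eq_lrshift mxE.
  - by rewrite block_mxEdl eq_rlshift mxE.
  - rewrite block_mxEdr eq_rshift !mxE; case: eqP => _ //.
    by rewrite gtr0_norm// mulfV// gt_eqF.
- move=> /allP rXY; apply/matrixP => i k; rewrite !mxE rmorphM /= aR.
  have /rXY/eqP : s`_i \in X ++ Y by rewrite -(perm_mem sXY).
  by move=> /rowP/(_ k); rewrite mxE => ->.
Qed.

Lemma split_sign_form (c e : 'rV[C]_(m + p)) :
  (c *m split_sign *m e^T) 0 0 =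
    (rsubmx c *m (rsubmx e)^T) 0 0 - (lsubmx c *m (lsubmx e)^T) 0 0.
Proof.
rewrite -{1}[c]hsubmxK -{1}[e]hsubmxK /split_sign mul_row_block !mulmx0.
rewrite addr0 add0r mulmxN !mulmx1 tr_row_mx mul_row_col mulNmx.
by rewrite [LHS]mxE [X in X + _]mxE addrC.
Qed.

Lemma herm_frame B (c : 'rV[C]_(m + p)) : B *m G *m (mxconj B)^T = split_sign ->
  H (c *m B) (c *m B) = sqnorm (rsubmx c) - sqnorm (lsubmx c).
Proof.
move=> BG; rewrite /herm mxconjM trmx_mul mulmxA -(mulmxA c) -(mulmxA c) BG.
rewrite split_sign_form; congr (_ - _); rewrite mxE;
  by apply: eq_bigr => i _; rewrite !mxE normCK.
Qed.

(** For a real frame the Gram matrices of the bilinear and of the Hermitian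
    form coincide. *)
Lemma bilin_frame B (c : 'rV[C]_(m + p)) : B *m G *m (mxconj B)^T = split_sign ->
  mxconj B = B ->
  (c *m B *m G *m (c *m B)^T) 0 0 = sqsum (rsubmx c) - sqsum (lsubmx c).
Proof.
move=> BG rB; rewrite trmx_mul mulmxA -(mulmxA c) -(mulmxA c) -{2}rB BG.
rewrite split_sign_form; congr (_ - _); rewrite mxE;
  by apply: eq_bigr => i _; rewrite !mxE expr2.
Qed.

Lemma frame_dual B : B *m G *m (mxconj B)^T = split_sign ->
  B *m (G *m (mxconj B)^T *m split_sign) = 1%:M.
Proof. by move=> BG; rewrite !mulmxA BG split_signK. Qed.

End Frame.

(** * The period quadric of the standard form *)

Section TypeIV.
Variables (R : realType) (m : nat).
Local Notation C := (Cplx R).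

Definition std_form : 'M[R]_(m + 2) := block_mx (- 1%:M) 0 0 1%:M.

Lemma map_std_form : map_mx (real_complex R) std_form = split_sign C m 2.
Proof.
by rewrite /std_form map_block_mx map_mxN !map_mx1 !map_mx0.
Qed.

Lemma std_form_signature : has_signature fullv (form idfun std_form) 2 m.
Proof.
pose tX := [seq rshift m i | i : 'I_2]; pose tY := [seq lshift 2 i | i : 'I_m].
pose e i : 'rV[R]_(m + 2) := delta_mx 0 i.
exists (map e tX), (map e tY).
have ee i j : form idfun std_form (e i) (e j) = std_form i j by exact: formee.
have ut : uniq (tX ++ tY).
  have uX : uniq tX by rewrite map_inj_uniq ?enum_uniq//; exact: rshift_inj.
  have uY : uniq tY by rewrite map_inj_uniq ?enum_uniq//; exact: lshift_inj.
  rewrite cat_uniq uX uY andbT; apply/hasPn => _ /mapP[i _ ->].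
  apply/mapP => -[j _ /eqP].
  by rewrite eq_lrshift.
have mt i : i \in tX ++ tY.
  rewrite mem_cat; case: (split_ordP i) => j ->; apply/orP; [right|left];
  by rewrite map_f ?mem_enum.
have sX : size tX = 2 by rewrite size_map -cardE card_ord.
have sY : size tY = m by rewrite size_map -cardE card_ord.
rewrite -map_cat; split.
- by rewrite size_map.
- by rewrite size_map.
- rewrite basisEdim size_map size_cat sX sY; apply/andP; split.
    apply/subvP => v _; rewrite (row_sum_delta v).
    by apply: memv_suml => i _; rewrite memvZ// memv_span// map_f.
  by rewrite dimvf; apply: eq_leq; rewrite addnC; exact: esym (mul1n _).
split.
- rewrite pairwise_map; apply: sub_pairwise (_ : pairwise (fun i j => i != j) _).
    move=> i j /=; rewrite ee /std_form.
    case: (split_ordP i) => i' ->; case: (split_ordP j) => j' ->.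
    + by rewrite block_mxEul eq_lshift !mxE => /negbTE ->; rewrite oppr0.
    + by rewrite block_mxEur mxE.
    + by rewrite block_mxEdl mxE.
    + by rewrite block_mxEdr eq_rshift !mxE => /negbTE ->.
  by rewrite -uniq_pairwise.
- rewrite all_map; apply/allP => _ /mapP[i _ ->] /=.
  by rewrite ee block_mxEdr mxE eqxx ltr01.
- rewrite all_map; apply/allP => _ /mapP[i _ ->] /=.
  by rewrite ee block_mxEul !mxE eqxx oppr_lt0 ltr01.
Qed.

(** In C^(m+2) with this form the standard basis is the frame, whence B = 1. *)
Lemma period_quadric_std :
  period_quadric std_form = proj_of (quadric_cone (1%:M : 'M[C]_(m + 2))).
Proof.
rewrite /period_quadric map_std_form /proj_of; congr (image _ _).
have qE (v : 'rV[C]_(m + 2)) : form idfun (split_sign C m 2) v v =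
    sqsum (rsubmx v) - sqsum (lsubmx v).
  rewrite /form map_mx_id// split_sign_form; congr (_ - _); rewrite mxE;
    by apply: eq_bigr => i _; rewrite !mxE expr2.
have hE (v : 'rV[C]_(m + 2)) : form idfun (split_sign C m 2) (mxconj v) v =
    sqnorm (rsubmx v) - sqnorm (lsubmx v).
  rewrite /form map_mx_id// split_sign_form; congr (_ - _); rewrite mxE;
    by apply: eq_bigr => i _; rewrite !mxE normCK mulrC.
apply/seteqP; split => v /=; rewrite /quadric_cone /= qE hE subr_gt0.
  move=> [/eqP + h]; rewrite subr_eq0 => /eqP q.
  by exists (vec v); rewrite mulmx1.
by move=> [c []]; rewrite mulmx1 => <- -> h; rewrite subrr.
Qed.

End TypeIV.

(** * The two halves of the quadric *)

Section Split.
Variables (R : realType) (n m : nat).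
Local Notation C := (Cplx R).
Variables (B : 'M[C]_(m + 2, n)) (K : 'M[C]_(n, m + 2)).
Hypothesis BK : B *m K = 1%:M.

Definition quadric_half (j : C) : set (projective R n) :=
  proj_of (quadric_cone B `&` half_cone K j).

Lemma quadric_halfE j :
  quadric_half j = proj_of (quadric_cone B) `&` proj_of (half_cone K j).
Proof.
exact: (proj_ofI (@cone_invariant_quadric _ _ _ B) (@cone_invariant_half _ _ _ K j)).
Qed.

Lemma open_in_quadric_half j : open_in (proj_of (quadric_cone B)) (quadric_half j).
Proof.
exists (proj_of (half_cone K j)); last exact: quadric_halfE.
by apply: open_proj_of; [exact: cone_invariant_half|exact: open_half_cone].
Qed.

Lemma proj_half_disjoint j :
  proj_of (half_cone K j) `&` proj_of (half_cone K (- j)) = set0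
    :> set (projective R n).
Proof.
rewrite -proj_ofI; [|exact: cone_invariant_half..].
by rewrite half_cone_disjoint; apply/seteqP; split => // p [v []].
Qed.

Variable j : C.
Hypothesis j2 : j ^+ 2 = -1.

Lemma proj_quadric_sub : proj_of (quadric_cone B) `<=`
  proj_of (half_cone K j) `|` proj_of (half_cone K (- j)).
Proof.
move=> _ [v Pv <-].
by case: (quadric_cone_half BK j2 Pv) => vj; [left|right]; exists v.
Qed.

Lemma quadric_half_union :
  proj_of (quadric_cone B) = quadric_half j `|` quadric_half (- j).
Proof.
rewrite !quadric_halfE -setIUr; apply/esym/setIidPl; exact: proj_quadric_sub.
Qed.

Lemma quadric_half_disjoint : quadric_half j `&` quadric_half (- j) = set0.
Proof. by rewrite !quadric_halfE setIACA proj_half_disjoint setI0. Qed.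

(** Each half is connected, as the image of the Lie ball, and relatively
    open. *)
Lemma quadric_half_component : exists2 x, proj_of (quadric_cone B) x &
  quadric_half j = connected_component (proj_of (quadric_cone B)) x.
Proof.
have s0 := quadric_section_neq0 BK j2 0.
have xD : quadric_half j (line (nonzero_of s0)).
  by exists (nonzero_of s0) => //; apply: (quadric_section_mem BK j2); exact: lie_ball0.
exists (line (nonzero_of s0)); first by move: xD; rewrite quadric_halfE => -[].
rewrite quadric_halfE; apply/esym/connected_component_split.
- by apply: open_proj_of; [exact: cone_invariant_half|exact: open_half_cone].
- by apply: (@open_proj_of _ _ (half_cone K (- j)));
    [exact: cone_invariant_half|exact: open_half_cone].
- exact: proj_quadric_sub.
- exact: proj_half_disjoint.
- by rewrite -quadric_halfE; exact: connected_quadric.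
- by rewrite -quadric_halfE.
Qed.

End Split.

(** * The period domain of the lattice *)

Lemma exists_prim_root (C : numClosedFieldType) d : (0 < d)%N ->
  exists z : C, d.-primitive_root z.
Proof.
move=> d0; pose p : {poly C} := 'X^d - 1.
have [r Dp] := closed_field_poly_normal p.
move: Dp; rewrite (monicP (monicXnsubC 1 d0)) scale1r => Dp.
have rn1 : all d.-unity_root r.
  by apply/allP => z; rewrite -root_prod_XsubC -Dp.
have sz_r : (d <= size r)%N by rewrite -ltnS -(size_prod_XsubC r id) -Dp size_XnsubC.
have [|z] := hasP (has_prim_root d0 rn1 _ sz_r); last by exists z.
by rewrite -separable_prod_XsubC -Dp separable_Xn_sub_1// pnatr_eq0 -lt0n.
Qed.


Section Lattice.
Variables (R : realType) (d : nat) (L : lattice) (g : orth_rep R d L).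
Local Notation C := (Cplx R).
Local Notation n := (rk L).

Definition gramC : 'M[C]_n := map_mx intr (gram L).

Lemma gramC_sym : gramC^T = gramC.
Proof. by rewrite /gramC map_trmx gram_sym. Qed.

Lemma mxconj_int p q (A : 'M[int]_(p, q)) :
  mxconj (map_mx intr A : 'M[C]_(p, q)) = map_mx intr A.
Proof. by apply/matrixP => i j; rewrite !mxE rmorph_int. Qed.

Lemma gramC_real : mxconj gramC = gramC.
Proof. exact: mxconj_int. Qed.

Lemma lattice_formCE u v : @lattice_formC R L u v = (u *m gramC *m v^T) 0 0.
Proof. by rewrite /lattice_formC /form map_mx_id. Qed.

Lemma lattice_hermE : @lattice_herm R L = herm gramC.
Proof.
by apply/funext => u; apply/funext => v; rewrite /lattice_herm lattice_formCE.
Qed.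

(** Apply invariance of the form to a primitive d-th root of unity z:
    (v, v) = (z v, z v) = z^2 (v, v), and z^2 <> 1 as d > 2. *)
Lemma LC1_isotropic v : (3 <= d)%N -> v \in LC1 g -> lattice_formC v v = 0.
Proof.
move=> d3; have d0 : (0 < d)%N by exact: leq_trans d3.
have [z zp] := exists_prim_root C d0.
move=> /(eigen1P _ _ d0)/(_ z (prim_expr_order zp)) vz.
have := rho_orth g (prim_expr_order zp) => /(congr1 (map_mx (intr : int -> C))).
rewrite !map_mxM -map_trmx -/gramC => Mz.
have : lattice_formC v v = z ^+ 2 * lattice_formC v v.
  pose M : 'M[C]_n := map_mx intr (g z).
  have E : v *m M *m gramC *m (v *m M)^T = v *m gramC *m v^T.
    by rewrite -[in RHS]Mz trmx_mul !mulmxA.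
  rewrite lattice_formCE -[in LHS]E vz -!scalemxAl linearZ /= -scalemxAr scalerA.
  by rewrite mxE -expr2.
move/eqP; rewrite -subr_eq0 -[X in X - _]mul1r -mulrBl mulf_eq0.
case/orP => [|/eqP //]; rewrite subr_eq0 eq_sym => /eqP z2.
have : (d %| 2)%N by rewrite (prim_order_dvd zp); apply/eqP.
by move=> /dvdn_leq -/(_ isT); rewrite leqNgt d3.
Qed.

(** The square roots of unity are real and the group acts by integral
    matrices, so that conjugation preserves the eigenvector equations. *)
Lemma LC1_conj v : d = 2%N -> v \in LC1 g -> mxconj v \in LC1 g.
Proof.
move=> d2; have d0 : (0 < d)%N by rewrite d2.
move=> /(eigen1P _ _ d0) vz; apply/(eigen1P _ _ d0) => z zd.
have zr : Num.conj z = z.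
  move: zd; rewrite d2 => /eqP; rewrite sqrf_eq1 => /orP[]/eqP ->.
    exact: rmorph1.
  exact: rmorphN1.
by rewrite -{2}zr -mxconjZ -vz// mxconjM mxconj_int.
Qed.

End Lattice.

Theorem proposition2p2 (R : realType) (d : nat) (L : lattice)
    (g : orth_rep R d L) (q : nat)
    (hd : (2 <= d)%N)
    (hL : exists r : nat, has_signature fullv (@lattice_form R L) 3 r)
    (h1 : exists r : nat,
        has_signature (LC1 g) (@lattice_herm R L) (if d == 2 then 2 else 1)%N r)
    (hq : q = \dim (LC1 g)) :
  (d = 2%N ->
    exists D1 D2 : set (projective R (rk L)),
      [/\ period_domain g = D1 `|` D2, D1 `&` D2 = set0,
          open_in (period_domain g) D1 /\ open_in (period_domain g) D2,
          exists X : set (projective R (q - 2 + 2)),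
            [/\ is_type_IV X, biholomorphic D1 X & biholomorphic D2 X] &
          has_complex_dim D1 (q - 2) /\ has_complex_dim D2 (q - 2)]) /\
  ((3 <= d)%N ->
    biholomorphic (period_domain g) (@type_I R 1 (q - 1)) /\
    biholomorphic (period_domain g) (@complex_ball R (q - 1))).
Proof.
have [r sgn] := h1; rewrite lattice_hermE in sgn.
have Gs := gramC_sym R L; have Gr := gramC_real R L.
split=> [d2|d3].
  rewrite (_ : (d == 2) = true) in sgn; last by apply/eqP.
  have [X [Y [[sX bXY ort rXY] [pX nY]]]] :=
    real_signature Gs Gr (fun v => LC1_conj d2) sgn.
  have sY : size Y = (q - 2)%N.
    rewrite hq (size_basis (n := size (X ++ Y)) (X := in_tuple _) bXY).
    by rewrite size_cat sX addKn.
  have [B [BU BG /(_ rXY) rB]] := normalized_frame Gs Gr sX sY bXY ort pX nY.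
  have BK := frame_dual BG; set K := (_ *m split_sign _ _ _) in BK.
  (* in the coordinates of the frame, LC1 is all of C^q and the two conditions
     are those of the standard quadric *)
  have -> : period_domain g = proj_of (quadric_cone B).
    rewrite /period_domain /proj_of; congr (image _ _).
    apply/seteqP; split => v /=;
      rewrite lattice_formCE -/(lattice_herm _ _) lattice_hermE.
      move=> [/BU[c ->]]; rewrite bilin_frame// (herm_frame _ BG) subr_gt0 => /eqP.
      by rewrite subr_eq0 => /eqP qc h; exists c.
    move=> [c [-> qc h]]; rewrite bilin_frame// (herm_frame _ BG) subr_gt0 qc subrr.
    by split => //; apply/BU; exists c.
  have i2 : ('i : Cplx R) ^+ 2 = -1 by exact: sqrCi.
  have i2' : (- 'i : Cplx R) ^+ 2 = -1 by rewrite sqrrN sqrCi.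
  have c1 := quadric_chart BK i2; have c2 := quadric_chart BK i2'.
  have B1 : (1%:M : 'M[Cplx R]_(q - 2 + 2)) *m 1%:M = 1%:M by rewrite mulmx1.
  have c0 := biholomorphic_sym (quadric_chart B1 i2).
  exists (quadric_half B K 'i), (quadric_half B K (- 'i)); split.
  - exact: quadric_half_union.
  - exact: quadric_half_disjoint.
  - by split; exact: open_in_quadric_half.
  - exists (quadric_half 1%:M 1%:M 'i); split.
    + exists (std_form R (q - 2)); split.
      * by rewrite /std_form tr_block_mx linearN /= !trmx1 !trmx0.
      * exact: std_form_signature.
      * rewrite period_quadric_std; exact: quadric_half_component.
    + exact: biholomorphic_trans c1 c0.
    + exact: biholomorphic_trans c2 c0.
  - split; [apply: biholomorphic_dim c1|apply: biholomorphic_dim c2];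
      exact: open_lie_ball.
have d2 : (d == 2) = false by apply/negbTE; rewrite neq_ltn d3 orbT.
rewrite d2 in sgn.
have [X [Y [[sX _ bXY ort] [pX nY]]]] := (signatureP Gs Gr _ _ _).1 sgn.
have sY : size Y = (q - 1)%N.
  rewrite hq (size_basis (n := size (X ++ Y)) (X := in_tuple _) bXY).
  by rewrite size_cat sX addKn.
have [B [BU BG _]] := normalized_frame Gs Gr sX sY bXY ort pX nY.
have -> : period_domain g = proj_of (ball_cone B).
  rewrite /period_domain /proj_of; congr (image _ _).
  apply/seteqP; split => v /=; rewrite -/(lattice_herm _ _) lattice_hermE.
    by move=> [/BU[c ->]] _; rewrite (herm_frame _ BG) subr_gt0 => h; exists c.
  move=> [c E h]; have vU : vec v \in LC1 g by apply/BU; exists c.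
  split; [exact: vU|exact: (LC1_isotropic d3 vU)|].
  by rewrite E (herm_frame _ BG) subr_gt0.
have c := ball_chart (frame_dual BG).
by rewrite type_I_ball.
Qed.
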